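(* Let $1/3<\alpha<1$ and let $a,b$ be complex numbers with $a+b\in\mathbb{R}$ and $ab>0$ (i.e. $ab$ is a positive real number). Then the shifted hypergeometric function $z\,{}_2F_1(a,b;a+b+1;z)$ is strongly starlike of order $\alpha$ if $$\big[(a-b)^2+6(a+b)-3\big]\sin^2\frac{\pi\alpha}{2}-a^2-ab-b^2\ge0.$$
   Context: $\mathbb{D}=\{z\in\mathbb{C}:|z|<1\}$. For $a,b,c\in\mathbb{C}$ with $c\ne0,-1,-2,\dots$, the Gaussian hypergeometric function is ${}_2F_1(a,b;c;z)=\sum_{n=0}^\infty\frac{(a)_n(b)_n}{(c)_n n!}z^n$ for $z\in\mathbb{D}$, where $(a)_0=1$ and $(a)_n=a(a+1)\cdots(a+n-1)$. For $\alpha\in(0,1)$, an analytic function $f$ on $\mathbb{D}$ with $f(0)=0$, $f'(0)=1$ is called strongly starlike of order $\alpha$ if $\left|\arg\frac{zf'(z)}{f(z)}\right|<\frac{\pi}{2}\alpha$ for all $z\in\mathbb{D}$ (the quotient taking the value $1$ at $z=0$). *)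

(* Defs.v *)
From Stdlib Require Export Reals.
From Stdlib Require Import Factorial Lra Psatz.
From Coquelicot Require Export Coquelicot.

Open Scope R_scope.

(** Principal argument, with values in (-PI, PI]; junk at 0. *)
Definition Carg (w : C) : R :=
  if Rle_dec 0 (Im w) then acos (Re w / Cmod w) else - acos (Re w / Cmod w).

Lemma Carg_spec (w : C) : w <> RtoC 0 ->
  - PI < Carg w <= PI /\
  Re w = Cmod w * cos (Carg w) /\ Im w = Cmod w * sin (Carg w).
Proof.
intros Hw.
assert (Hm : 0 < Cmod w) by now apply Cmod_gt_0.
assert (H2 : Cmod w ^ 2 = Re w ^ 2 + Im w ^ 2) by apply Cmod2_alt.
pose proof PI_RGT_0 as Hpi.
set (x := Re w / Cmod w).
assert (Hx2 : 1 - x² = (Im w / Cmod w)²).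
{ unfold x, Rsqr.
  replace (Re w / Cmod w * (Re w / Cmod w)) with (Re w ^ 2 / Cmod w ^ 2)
    by (field; lra).
  replace (Re w ^ 2) with (Cmod w ^ 2 - Im w ^ 2) by lra.
  field; lra. }
assert (Hx : -1 <= x <= 1).
{ pose proof (Rle_0_sqr (Im w / Cmod w)) as Hs.
  rewrite <- Hx2 in Hs. unfold Rsqr in Hs. split; nra. }
assert (HR : Cmod w * x = Re w) by (unfold x; field; lra).
assert (HI : Cmod w * (Im w / Cmod w) = Im w) by (field; lra).
pose proof (acos_bound x) as Hb.
assert (Hsin : sin (acos x) = Rabs (Im w / Cmod w)).
{ rewrite sin_acos by exact Hx. rewrite Hx2. apply sqrt_Rsqr_abs. }
unfold Carg; fold x; destruct (Rle_dec 0 (Im w)) as [Hi|Hi].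
- split; [lra|]. rewrite cos_acos by exact Hx. rewrite Hsin, Rabs_pos_eq.
  + split; lra.
  + apply Rmult_le_pos; [exact Hi|]. now apply Rlt_le, Rinv_0_lt_compat.
- assert (Hn : Im w / Cmod w < 0).
  { pose proof (Rinv_0_lt_compat _ Hm). unfold Rdiv. nra. }
  rewrite Rabs_left in Hsin by exact Hn.
  assert (acos x <> PI).
  { intros E. rewrite E, sin_PI in Hsin. lra. }
  split; [lra|]. rewrite cos_neg, sin_neg, cos_acos by exact Hx.
  rewrite Hsin. split; lra.
Qed.

(** Sum of the complex power series with coefficients [a], computed on real and
    imaginary parts since [PSeries] is real-valued; junk if it diverges. *)
Definition CPSeries (a : nat -> C) (z : C) : C :=
  (Series (fun n => Re (a n * z ^ n)%C), Series (fun n => Im (a n * z ^ n)%C)).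

Lemma is_pseries_CPSeries (a : nat -> C) (z l : C) :
  @is_pseries C_AbsRing C_NormedModule a z l -> CPSeries a z = l.
Proof.
intros H.
assert (Hp : forall n, pow_n (K := C_AbsRing) z n = (z ^ n)%C).
{ induction n as [|n IH]; [reflexivity|]. simpl. now rewrite IH. }
assert (Hs : forall n,
  sum_n (fun k => scal (V := C_NormedModule) (pow_n (K := C_AbsRing) z k) (a k)) n
  = (sum_n (fun k => Re (a k * z ^ k)%C) n, sum_n (fun k => Im (a k * z ^ k)%C) n)).
{ induction n as [|n IH].
  - rewrite !sum_O. rewrite Hp.
    change (((z ^ 0) * a 0%nat)%C = (Re (a 0%nat * z ^ 0)%C, Im (a 0%nat * z ^ 0)%C)).
    rewrite Cmult_comm. apply surjective_pairing.
  - rewrite !sum_Sn, IH, Hp.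
    change (((sum_n (fun k => Re (a k * z ^ k)%C) n,
              sum_n (fun k => Im (a k * z ^ k)%C) n)
            + z ^ S n * a (S n))%C
      = (sum_n (fun k => Re (a k * z ^ k)%C) n + Re (a (S n) * z ^ S n)%C,
         sum_n (fun k => Im (a k * z ^ k)%C) n + Im (a (S n) * z ^ S n)%C)).
    now rewrite (Cmult_comm (z ^ S n)). }
unfold is_pseries, is_series in H.
unfold CPSeries. rewrite (surjective_pairing l). f_equal; apply is_series_unique.
- intros P [e He]. unfold filtermap. specialize (H (fun w => P (fst w))).
  assert (HP : locally (l : C_NormedModule) (fun w : C => P (fst w))).
  { exists e. intros y Hy. apply He. apply Hy. }
  destruct (H HP) as [N HN]. exists N. intros n Hn.
  specialize (HN n Hn). now rewrite Hs in HN.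
- intros P [e He]. unfold filtermap. specialize (H (fun w => P (snd w))).
  assert (HP : locally (l : C_NormedModule) (fun w : C => P (snd w))).
  { exists e. intros y Hy. apply He. apply Hy. }
  destruct (H HP) as [N HN]. exists N. intros n Hn.
  specialize (HN n Hn). now rewrite Hs in HN.
Qed.

(** Rising factorial a (a + 1) ... (a + n - 1). *)
Fixpoint Cpoch (a : C) (n : nat) : C :=
  match n with
  | O => RtoC 1
  | S m => (Cpoch a m * (a + RtoC (INR m)))%C
  end.

(** Meaningful for [c] not in {0, -1, -2, ...} and [Cmod z < 1]. *)
Definition hyp2F1 (a b c z : C) : C :=
  CPSeries
    (fun n => (Cpoch a n * Cpoch b n / (Cpoch c n * RtoC (INR (fact n))))%C) z.

Definition analytic_on_disk (f : C -> C) : Prop :=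
  forall z : C, Cmod z < 1 -> @ex_derive C_AbsRing C_NormedModule f z.

Definition starlike_quot (f : C -> C) (z : C) : C :=
  if Ceq_dec z (RtoC 0) then RtoC 1 else (z * C_derive f z / f z)%C.

(** The two non-vanishing clauses say that the quotient and its argument are
    defined: division by 0 and [Carg] at 0 are total in the code. *)
Definition strongly_starlike (alpha : R) (f : C -> C) : Prop :=
  analytic_on_disk f /\
  f (RtoC 0) = RtoC 0 /\
  C_derive f (RtoC 0) = RtoC 1 /\
  forall z : C, Cmod z < 1 ->
    (z <> RtoC 0 -> f z <> RtoC 0) /\
    starlike_quot f z <> RtoC 0 /\
    Rabs (Carg (starlike_quot f z)) < PI / 2 * alpha.

(* Main.v *)
(** Write F for the hypergeometric function, s = a + b, m = ab, q = z f'/f = 1 + zF'/F.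
    The hypergeometric equation becomes the Riccati equation
    zq' + (q - 1)^2 + s (q - 1) = m z/(1 - z), whose right-hand side has real part > - m/2.
    The sector |arg q| < phi = pi alpha/2 is the intersection of the half-planes
    Re (eps q) > 0 with eps = sin phi + i n, n = cos phi or n = - cos phi, so it suffices
    to treat one half-plane.  Otherwise let z0 be a point of least modulus where
    Re (eps q) = 0.  The Schwarz function w = eps zF' / (eps zF' + 2 sin phi F) of the
    half-plane then has |w(z)| <= |z|/|z0| by the maximum principle, so (Jack's lemma)
    z0 w'(z0)/w(z0) is real and >= 1.  Inserting this in the Riccati equation bounds the real
    part of m z0/(1 - z0) by a quadratic polynomial in the position on the line
    Re (eps q) = 0, and the hypothesis on a and b says exactly that this polynomial is
    <= - m/2 everywhere, a contradiction.  Since w is homogeneous in (F, zF'), a zero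
    of F is just another point where |w| = 1. *)

Require Import Defs.
From Stdlib Require Import Reals Lra Factorial Classical ClassicalEpsilon.
From Coquelicot Require Import Coquelicot.
Open Scope R_scope.

(** * Complex derivatives *)

(** Little-o form without a quotient: [h = 0] needs no exclusion, and the product and inverse rules
    become plain inequalities on increments. *)
Definition is_cderive (f : C -> C) (z l : C) : Prop :=
  forall eps, 0 < eps -> exists d, 0 < d /\
    forall h : C, Cmod h < d -> Cmod (f (z + h) - f z - l * h)%C <= eps * Cmod h.

Lemma is_cderive_is_derive (f : C -> C) (z l : C) :
  is_cderive f z l -> @is_derive C_AbsRing C_NormedModule f z l.
Proof.
intros H. split; [apply is_linear_scal_l|].
intros x Hx.
assert (E : z = x) by exact (is_filter_lim_locally_unique (V := AbsRing_NormedModule C_AbsRing) _ _ Hx).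
subst x. intros eps.
destruct (H eps (cond_pos eps)) as [d [Hd H']].
exists (mkposreal d Hd). intros y Hy.
change (Cmod (minus y z) < d) in Hy.
specialize (H' (minus y z) Hy).
change (z + minus y z)%C with (z + (y - z))%C in H'.
replace (z + (y - z))%C with (y : C) in H' by (generalize (y : C); intros w; ring).
assert (E : (f y - f z - l * minus y z)%C
  = minus (G := C_NormedModule) (minus (G := C_NormedModule) (f y) (f z))
      (scal (V := C_NormedModule) (minus y z) l)).
{ rewrite Cmult_comm. reflexivity. }
rewrite E in H'. exact H'.
Qed.

Lemma is_cderive_eq (f : C -> C) (z l l' : C) :
  is_cderive f z l -> l = l' -> is_cderive f z l'.
Proof. intros H <-; exact H. Qed.

Lemma is_cderive_const (c z : C) : is_cderive (fun _ => c) z 0.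
Proof.
intros eps He. exists 1; split; [lra|]. intros h _.
replace (c - c - 0 * h)%C with (RtoC 0) by ring. rewrite Cmod_0.
apply Rmult_le_pos; [lra | apply Cmod_ge_0].
Qed.

Lemma is_cderive_id (z : C) : is_cderive (fun w => w) z 1.
Proof.
intros eps He. exists 1; split; [lra|]. intros h _.
replace (z + h - z - 1 * h)%C with (RtoC 0) by ring. rewrite Cmod_0.
apply Rmult_le_pos; [lra | apply Cmod_ge_0].
Qed.

Lemma is_cderive_plus (f g : C -> C) (z lf lg : C) :
  is_cderive f z lf -> is_cderive g z lg ->
  is_cderive (fun w => f w + g w)%C z (lf + lg)%C.
Proof.
intros Hf Hg eps He.
destruct (Hf (eps / 2)) as [d1 [Hd1 H1]]; [lra|].
destruct (Hg (eps / 2)) as [d2 [Hd2 H2]]; [lra|].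
exists (Rmin d1 d2); split; [now apply Rmin_glb_lt|]. intros h Hh.
specialize (H1 h (Rlt_le_trans _ _ _ Hh (Rmin_l _ _))).
specialize (H2 h (Rlt_le_trans _ _ _ Hh (Rmin_r _ _))).
replace (f (z + h) + g (z + h) - (f z + g z) - (lf + lg) * h)%C
  with ((f (z + h) - f z - lf * h) + (g (z + h) - g z - lg * h))%C by ring.
eapply Rle_trans; [apply Cmod_triangle|]. lra.
Qed.

Lemma is_cderive_opp (f : C -> C) (z l : C) :
  is_cderive f z l -> is_cderive (fun w => - f w)%C z (- l)%C.
Proof.
intros H eps He. destruct (H eps He) as [d [Hd H']]. exists d; split; [exact Hd|].
intros h Hh. rewrite <- Cmod_opp.
replace (- (- f (z + h) - - f z - - l * h))%C with (f (z + h) - f z - l * h)%C by ring.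
now apply H'.
Qed.

Lemma is_cderive_lipschitz (f : C -> C) (z l : C) : is_cderive f z l ->
  exists d, 0 < d /\ forall h : C, Cmod h < d ->
    Cmod (f (z + h) - f z)%C <= (Cmod l + 1) * Cmod h.
Proof.
intros H. destruct (H 1) as [d [Hd H1]]; [lra|].
exists d; split; [exact Hd|]. intros h Hh. specialize (H1 h Hh).
replace (f (z + h) - f z)%C with ((f (z + h) - f z - l * h) + l * h)%C by ring.
eapply Rle_trans; [apply Cmod_triangle|]. rewrite Cmod_mult. lra.
Qed.

Lemma is_cderive_mult (f g : C -> C) (z lf lg : C) :
  is_cderive f z lf -> is_cderive g z lg ->
  is_cderive (fun w => f w * g w)%C z (lf * g z + f z * lg)%C.
Proof.
intros Hf Hg eps He.
destruct (is_cderive_lipschitz _ _ _ Hf) as [d3 [Hd3 H3]].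
destruct (is_cderive_lipschitz _ _ _ Hg) as [d4 [Hd4 H4]].
(* [M] absorbs the two first-order errors and [L] the product of the increments, which is quadratic
   in [h]; each receives half of [eps]. *)
set (L := (Cmod lf + 1) * (Cmod lg + 1)).
set (M := Cmod (f z) + Cmod (g z) + 1).
pose proof (Cmod_ge_0 lf) as P1. pose proof (Cmod_ge_0 lg) as P2.
pose proof (Cmod_ge_0 (f z)) as P3. pose proof (Cmod_ge_0 (g z)) as P4.
assert (HL : 0 < L) by (unfold L; nra).
assert (HM : 0 < M) by (unfold M; lra).
assert (He' : 0 < eps / (2 * M)) by (apply Rdiv_lt_0_compat; lra).
destruct (Hf _ He') as [d1 [Hd1 H1]].
destruct (Hg _ He') as [d2 [Hd2 H2]].
assert (Hd5 : 0 < eps / (2 * L)) by (apply Rdiv_lt_0_compat; lra).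
exists (Rmin (eps / (2 * L)) (Rmin (Rmin d1 d2) (Rmin d3 d4))); split.
{ repeat apply Rmin_glb_lt; assumption. }
intros h Hh.
apply Rmin_Rgt in Hh; destruct Hh as [Hh5 Hh].
apply Rmin_Rgt in Hh; destruct Hh as [Hh12 Hh34].
apply Rmin_Rgt in Hh12; destruct Hh12 as [Hh1 Hh2].
apply Rmin_Rgt in Hh34; destruct Hh34 as [Hh3 Hh4].
specialize (H1 h Hh1). specialize (H2 h Hh2).
specialize (H3 h Hh3). specialize (H4 h Hh4).
replace (f (z + h) * g (z + h) - f z * g z - (lf * g z + f z * lg) * h)%C
  with ((f (z + h) - f z - lf * h) * g z + f z * (g (z + h) - g z - lg * h)
        + (f (z + h) - f z) * (g (z + h) - g z))%C by ring.
eapply Rle_trans; [apply Cmod_triangle|].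
eapply Rle_trans; [apply Rplus_le_compat_r, Cmod_triangle|].
rewrite !Cmod_mult.
set (x := Cmod h) in *. pose proof (Cmod_ge_0 h : 0 <= x) as Hx.
assert (K1 : Cmod (f (z + h) - f z - lf * h)%C * Cmod (g z)
  <= eps / (2 * M) * x * Cmod (g z)) by (apply Rmult_le_compat_r; lra).
assert (K2 : Cmod (f z) * Cmod (g (z + h) - g z - lg * h)%C
  <= Cmod (f z) * (eps / (2 * M) * x)) by (apply Rmult_le_compat_l; lra).
assert (K3 : Cmod (f (z + h) - f z)%C * Cmod (g (z + h) - g z)%C <= L * x * x).
{ replace (L * x * x) with (((Cmod lf + 1) * x) * ((Cmod lg + 1) * x))
    by (unfold L; ring).
  apply Rmult_le_compat; try apply Cmod_ge_0; assumption. }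
assert (K4 : L * x * x <= eps / 2 * x).
{ apply Rmult_le_compat_r; [exact Hx|].
  apply Rlt_le. replace (eps / 2) with (L * (eps / (2 * L))) by (field; lra).
  apply Rmult_lt_compat_l; [exact HL | exact Hh5]. }
assert (K5 : eps / (2 * M) * x * M = eps / 2 * x) by (field; lra).
assert (K6 : 0 <= eps / (2 * M) * x) by (apply Rmult_le_pos; lra).
unfold M in K5. unfold M in *. nra.
Qed.

Lemma is_cderive_inv (g : C -> C) (z l : C) :
  is_cderive g z l -> g z <> 0 ->
  is_cderive (fun w => / g w)%C z (- l / (g z * g z))%C.
Proof.
intros Hg Hgz eps He.
assert (HG : 0 < Cmod (g z)) by now apply Cmod_gt_0.
destruct (is_cderive_lipschitz _ _ _ Hg) as [d3 [Hd3 H3]].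
set (G := Cmod (g z)) in *. set (L := Cmod l + 1).
pose proof (Cmod_ge_0 l) as Hl0.
assert (HL : 0 < L) by (unfold L; lra).
assert (He1 : 0 < eps * (G * G) / 4) by (apply Rdiv_lt_0_compat; [|lra]; repeat apply Rmult_lt_0_compat; lra).
destruct (Hg _ He1) as [d1 [Hd1 H1]].
assert (Hd2 : 0 < G / (2 * L)) by (apply Rdiv_lt_0_compat; lra).
assert (Hd4 : 0 < eps * (G * G * G) / (4 * (L * L)))
  by (apply Rdiv_lt_0_compat; repeat apply Rmult_lt_0_compat; lra).
(* The bound [G / (2 * L)] keeps |g(z + h)| at least [G / 2]. The last bound makes the quadratic
   error at most [eps * G^3 / 4] times |h|, and the choice of [d1] does the same for the linear
   error. The sum is absorbed by [eps * G^2 * y] because [y >= G / 2]. *)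
exists (Rmin (Rmin d1 d3) (Rmin (G / (2 * L)) (eps * (G * G * G) / (4 * (L * L)))));
  split.
{ repeat apply Rmin_glb_lt; assumption. }
intros h Hh.
apply Rmin_Rgt in Hh; destruct Hh as [Hh13 Hh24].
apply Rmin_Rgt in Hh13; destruct Hh13 as [Hh1 Hh3].
apply Rmin_Rgt in Hh24; destruct Hh24 as [Hh2 Hh4].
specialize (H1 h Hh1). specialize (H3 h Hh3). fold L in H3.
set (x := Cmod h) in *. pose proof (Cmod_ge_0 h : 0 <= x) as Hx.
assert (Hlow : G / 2 <= Cmod (g (z + h)%C)).
{ pose proof (Cmod_triangle (g (z + h)%C) (- (g (z + h) - g z))%C) as T.
  rewrite Cmod_opp in T.
  replace (g (z + h) + - (g (z + h) - g z))%C with (g z) in T by ring.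
  fold G in T.
  assert (L * x <= L * (G / (2 * L))) by (apply Rmult_le_compat_l; lra).
  replace (L * (G / (2 * L))) with (G / 2) in H by (field; lra). lra. }
assert (Hgh : g (z + h)%C <> 0) by (apply Cmod_gt_0; lra).
replace (/ g (z + h) - / g z - - l / (g z * g z) * h)%C
  with ((- (g (z + h) - g z - l * h) * g z + l * h * (g (z + h) - g z))
        / (g z * g z * g (z + h)))%C
  by (field; split; assumption).
rewrite Cmod_div by (repeat apply Cmult_neq_0; assumption).
rewrite !Cmod_mult. fold G.
set (y := Cmod (g (z + h)%C)) in *.
assert (Hy : 0 < G * G * y) by (repeat apply Rmult_lt_0_compat; lra).
apply Rmult_le_reg_r with (1 := Hy).
unfold Rdiv at 1. rewrite Rmult_assoc, Rinv_l, Rmult_1_r by lra.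
eapply Rle_trans; [apply Cmod_triangle|].
rewrite !Cmod_mult, Cmod_opp. fold x G.
assert (K1 : Cmod (g (z + h) - g z - l * h)%C * G <= eps * (G * G) / 4 * x * G)
  by (apply Rmult_le_compat_r; lra).
assert (K2 : Cmod l * x * Cmod (g (z + h) - g z)%C <= L * x * (L * x)).
{ apply Rmult_le_compat; try apply Cmod_ge_0; try assumption.
  - apply Rmult_le_pos; [apply Cmod_ge_0 | exact Hx].
  - apply Rmult_le_compat_r; unfold L; lra. }
assert (K3 : L * L * x <= eps * (G * G * G) / 4).
{ apply Rle_trans with (L * L * (eps * (G * G * G) / (4 * (L * L)))).
  - apply Rmult_le_compat_l; [nra | lra].
  - right; field; lra. }
assert (K4 : L * L * x * x <= eps * (G * G * G) / 4 * x)
  by (apply Rmult_le_compat_r; assumption).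
assert (K5 : eps * x * (G * G * (G / 2)) <= eps * x * (G * G * y)).
{ apply Rmult_le_compat_l; [apply Rmult_le_pos; lra|].
  apply Rmult_le_compat_l; [nra|exact Hlow]. }
lra.
Qed.

(** Cauchy-Riemann: multiplication by [l] is the real matrix with rows (Re l, - Im l) and (Im l, Re
    l). The factor [sqrt 2] compares the modulus with the maximum norm used for real
    differentiability. *)
Lemma is_cderive_differentiable_pt (f : C -> C) (x y : R) (l : C) :
  is_cderive f (x, y) l ->
  differentiable_pt_lim (fun u v => Re (f (u, v))) x y (Re l) (- Im l) /\
  differentiable_pt_lim (fun u v => Im (f (u, v))) x y (Im l) (Re l).
Proof.
intros H.
assert (K : forall eps : posreal, locally_2d (fun u v =>
  Cmod (f (u, v) - f (x, y) - l * ((u - x)%R, (v - y)%R))%C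
    <= eps * Rmax (Rabs (u - x)) (Rabs (v - y))) x y).
{ intros eps. pose proof (cond_pos eps) as He.
  assert (Hs : 0 < sqrt 2) by (apply sqrt_lt_R0; lra).
  destruct (H (eps / sqrt 2)) as [d [Hd H']]; [now apply Rdiv_lt_0_compat|].
  assert (Hd' : 0 < d / sqrt 2) by now apply Rdiv_lt_0_compat.
  exists (mkposreal _ Hd'). intros u v Hu Hv. simpl in Hu, Hv.
  pose proof (Cmod_2Rmax (u - x, v - y)) as Hm. simpl in Hm.
  assert (Hh : Cmod (u - x, v - y) < d).
  { eapply Rle_lt_trans; [exact Hm|].
    replace d with (sqrt 2 * (d / sqrt 2)) by (field; lra).
    apply Rmult_lt_compat_l; [exact Hs|]. now apply Rmax_lub_lt. }
  specialize (H' _ Hh).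
  replace ((x, y) + ((u - x)%R, (v - y)%R))%C with (u, v) in H'
    by (unfold Cplus; simpl; f_equal; ring).
  eapply Rle_trans; [exact H'|].
  replace (eps * Rmax (Rabs (u - x)) (Rabs (v - y)))
    with (eps / sqrt 2 * (sqrt 2 * Rmax (Rabs (u - x)) (Rabs (v - y))))
    by (field; lra).
  apply Rmult_le_compat_l; [|exact Hm]. apply Rlt_le, Rdiv_lt_0_compat; assumption. }
split; intros eps; destruct (K eps) as [d Hd]; exists d; intros u v Hu Hv;
  (eapply Rle_trans; [|exact (Hd u v Hu Hv)]);
  (eapply Rle_trans; [|apply Rmax_Cmod]).
- eapply Rle_trans; [|apply Rmax_l]. right. f_equal. unfold Re, Im; simpl. ring.
- eapply Rle_trans; [|apply Rmax_r]. right. f_equal. unfold Re, Im; simpl. ring.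
Qed.

Lemma is_cderive_curve (f : C -> C) (x y : R -> R) (t dx dy : R) (l : C) :
  is_cderive f (x t, y t) l -> is_derive x t dx -> is_derive y t dy ->
  is_derive (fun r => Re (f (x r, y r))) t (Re (l * (dx, dy))%C) /\
  is_derive (fun r => Im (f (x r, y r))) t (Im (l * (dx, dy))%C).
Proof.
intros H Hx Hy. apply is_cderive_differentiable_pt in H. destruct H as [H1 H2].
apply is_derive_Reals in Hx. apply is_derive_Reals in Hy.
split; apply is_derive_Reals.
- replace (Re (l * (dx, dy))%C) with (Re l * dx + - Im l * dy)
    by (unfold Re, Im; simpl; ring).
  exact (derivable_pt_lim_comp_2d _ _ _ _ _ _ _ _ H1 Hx Hy).
- replace (Im (l * (dx, dy))%C) with (Im l * dx + Re l * dy)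
    by (unfold Re, Im; simpl; ring).
  exact (derivable_pt_lim_comp_2d _ _ _ _ _ _ _ _ H2 Hx Hy).
Qed.

Lemma is_derive_Cmod2_curve (f : C -> C) (x y : R -> R) (t dx dy : R) (l : C) :
  is_cderive f (x t, y t) l -> is_derive x t dx -> is_derive y t dy ->
  is_derive (fun r => Cmod (f (x r, y r)) ^ 2) t
    (2 * Re (Cconj (f (x t, y t)) * (l * (dx, dy)))%C).
Proof.
intros H Hx Hy.
destruct (is_cderive_curve f x y t dx dy l H Hx Hy) as [H1 H2].
apply is_derive_ext with (fun r => Re (f (x r, y r)) ^ 2 + Im (f (x r, y r)) ^ 2).
{ intros r. symmetry. apply Cmod2_alt. }
evar_last.
{ apply (is_derive_plus (V := R_NormedModule)); apply is_derive_pow; eassumption. }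
unfold Re, Im, plus; simpl. ring.
Qed.

Lemma is_derive_inner_curve (f g : C -> C) (x y : R -> R) (t dx dy : R) (lf lg : C) :
  is_cderive f (x t, y t) lf -> is_cderive g (x t, y t) lg ->
  is_derive x t dx -> is_derive y t dy ->
  is_derive (fun r => Re (Cconj (f (x r, y r)) * g (x r, y r))%C) t
    (Re (Cconj (lf * (dx, dy)) * g (x t, y t)
         + Cconj (f (x t, y t)) * (lg * (dx, dy)))%C).
Proof.
intros Hf Hg Hx Hy.
destruct (is_cderive_curve f x y t dx dy lf Hf Hx Hy) as [F1 F2].
destruct (is_cderive_curve g x y t dx dy lg Hg Hx Hy) as [G1 G2].
apply is_derive_ext with (fun r => Re (f (x r, y r)) * Re (g (x r, y r))
  + Im (f (x r, y r)) * Im (g (x r, y r))).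
{ intros r. unfold Re, Im; simpl. ring. }
evar_last.
{ apply (is_derive_plus (V := R_NormedModule));
    (apply (is_derive_mult (K := R_AbsRing)); [eassumption..|apply Rmult_comm]). }
unfold Re, Im, plus, mult; simpl. ring.
Qed.

(** * Maximum modulus principle *)

(** Maximize first in [y], choosing a maximizer [Y x] for each [x], then in [x]. The function of [x]
    so obtained is continuous because [v] is uniformly continuous on the rectangle, although [Y]
    itself need not be. *)
Lemma rectangle_max (v : R -> R -> R) (a b c d : R) : a <= b -> c <= d ->
  (forall x y, a <= x <= b -> c <= y <= d -> continuity_2d_pt v x y) ->
  exists x0 y0, a <= x0 <= b /\ c <= y0 <= d /\
    forall x y, a <= x <= b -> c <= y <= d -> v x y <= v x0 y0.
Proof.
intros Hab Hcd Hc.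
assert (HY : forall x, exists y0, a <= x <= b ->
  c <= y0 <= d /\ forall y, c <= y <= d -> v x y <= v x y0).
{ intros x. destruct (classic (a <= x <= b)) as [Hx|Hx]; [|exists 0; tauto].
  destruct (continuity_ab_maj (v x) c d Hcd) as [y0 [H1 H2]].
  - intros y Hy. specialize (Hc x y Hx Hy).
    apply continuity_pt_locally. intros eps. destruct (Hc eps) as [del Hdel].
    exists del. intros w Hw. apply Hdel; [|exact Hw].
    rewrite Rminus_diag, Rabs_R0. apply cond_pos.
  - exists y0. tauto. }
assert (HYe : exists Y : R -> R, forall x, a <= x <= b ->
  c <= Y x <= d /\ forall y, c <= y <= d -> v x y <= v x (Y x)).
{ exists (fun x => proj1_sig (constructive_indefinite_description _ (HY x))).
  intros x. exact (proj2_sig (constructive_indefinite_description _ (HY x))). }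
destruct HYe as [Y HYs].
(* The one-variable extremum theorem wants two-sided continuity, also at the endpoints, so the
   function of [x] is extended to the whole line by clamping its argument to [a, b]; clamping is
   1-Lipschitz. *)
pose (cl x := Rmax a (Rmin b x)).
assert (Hcl : forall x, a <= cl x <= b).
{ intros x. unfold cl. split; [apply Rmax_l|]. apply Rmax_lub; [lra|apply Rmin_l]. }
assert (Hcl2 : forall x, a <= x <= b -> cl x = x).
{ intros x Hx. unfold cl. rewrite Rmin_right, Rmax_right; lra. }
assert (Hcl3 : forall x w, Rabs (cl x - cl w) <= Rabs (x - w)).
{ intros x w. unfold cl, Rmax, Rmin.
  repeat (destruct Rle_dec); unfold Rabs; repeat (destruct Rcase_abs); lra. }
destruct (continuity_ab_maj (fun x => v (cl x) (Y (cl x))) a b Hab) as [x0 [H1 H2]].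
- intros x _. apply continuity_pt_locally. intros eps.
  destruct (uniform_continuity_2d v a b c d Hc eps) as [del Hdel].
  exists del. intros w Hw. change (Rabs (w - x) < del) in Hw.
  assert (K : forall p q, Rabs (p - q) < del ->
    v (cl p) (Y (cl p)) - v (cl q) (Y (cl q)) < eps).
  { intros p q Hpq.
    destruct (HYs (cl p) (Hcl p)) as [Hp1 Hp2].
    destruct (HYs (cl q) (Hcl q)) as [Hq1 Hq2].
    pose proof (Hq2 _ Hp1) as Hle.
    assert (D : Rabs (v (cl p) (Y (cl p)) - v (cl q) (Y (cl p))) < eps).
    { apply Hdel; try apply Hcl; try assumption.
      - eapply Rle_lt_trans; [apply Hcl3|exact Hpq].
      - rewrite Rminus_diag, Rabs_R0. apply cond_pos. }
    apply Rabs_def2 in D. lra. }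
  pose proof (K w x Hw). rewrite Rabs_minus_sym in Hw. pose proof (K x w Hw).
  apply Rabs_def1; lra.
- exists x0, (Y x0). destruct (HYs x0 H2) as [K1 K2]. repeat split; try tauto.
  intros x y Hx Hy. specialize (H1 x Hx). rewrite !Hcl2 in H1 by assumption.
  destruct (HYs x Hx) as [_ K3]. specialize (K3 y Hy). lra.
Qed.

Lemma polar (z : C) : exists t, 0 <= t <= 2 * PI /\
  z = (Cmod z * cos t, Cmod z * sin t).
Proof.
pose proof PI_RGT_0.
destruct (Ceq_dec z 0) as [->|Hz].
- exists 0. rewrite Cmod_0, !Rmult_0_l. split; [lra|reflexivity].
- destruct (Carg_spec z Hz) as [Hb [H1 H2]].
  destruct (Rle_dec 0 (Carg z)) as [Hp|Hp].
  + exists (Carg z). split; [lra|]. rewrite <- H1, <- H2. apply surjective_pairing.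
  + exists (Carg z + 2 * PI). split; [lra|].
    rewrite cos_plus, sin_plus, cos_2PI, sin_2PI.
    replace (Cmod z * (cos (Carg z) * 1 - sin (Carg z) * 0))
      with (Cmod z * cos (Carg z)) by ring.
    replace (Cmod z * (sin (Carg z) * 1 + cos (Carg z) * 0))
      with (Cmod z * sin (Carg z)) by ring.
    rewrite <- H1, <- H2. apply surjective_pairing.
Qed.

Lemma Cmod_polar (r t : R) : 0 <= r -> Cmod (r * cos t, r * sin t) = r.
Proof.
intros Hr. unfold Cmod; simpl.
replace (r * cos t * (r * cos t * 1) + r * sin t * (r * sin t * 1))
  with (r * r * (sin t * sin t + cos t * cos t)) by ring.
fold (Rsqr (sin t)) (Rsqr (cos t)). rewrite sin2_cos2, Rmult_1_r.
now apply sqrt_square.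
Qed.

Lemma continuity_2d_pt_polar (u : C -> R) (r t : R) :
  continuity_2d_pt (fun x y => u (x, y)) (r * cos t) (r * sin t) ->
  continuity_2d_pt (fun r t => u (r * cos t, r * sin t)) r t.
Proof.
intros H eps. destruct (H eps) as [d Hd].
assert (H1 : continuity_2d_pt (fun r t => r * cos t) r t).
{ apply continuity_2d_pt_mult; [apply continuity_2d_pt_id1|].
  apply (continuity_1d_2d_pt_comp cos (fun _ t => t));
    [apply continuity_cos | apply continuity_2d_pt_id2]. }
assert (H2 : continuity_2d_pt (fun r t => r * sin t) r t).
{ apply continuity_2d_pt_mult; [apply continuity_2d_pt_id1|].
  apply (continuity_1d_2d_pt_comp sin (fun _ t => t));
    [apply continuity_sin | apply continuity_2d_pt_id2]. }
apply (locally_2d_impl _ _ _ _ ) with (2 := H1 d).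
apply (locally_2d_impl _ _ _ _ ) with (2 := H2 d).
apply locally_2d_forall. intros p q Hs Hcs. now apply Hd.
Qed.

(** Polar coordinates turn the disk into the image of the rectangle [0, R0] x [0, 2 pi]. *)
Lemma disk_max (u : C -> R) (R0 : R) : 0 <= R0 ->
  (forall z, Cmod z <= R0 -> continuity_2d_pt (fun x y => u (x, y)) (Re z) (Im z)) ->
  exists z0, Cmod z0 <= R0 /\ forall z, Cmod z <= R0 -> u z <= u z0.
Proof.
intros HR Hc. pose proof PI_RGT_0.
destruct (rectangle_max (fun r t => u (r * cos t, r * sin t)) 0 R0 0 (2 * PI))
  as [r0 [t0 [Hr [Ht Hm]]]]; [lra|lra| |].
- intros r t Hr Ht. apply continuity_2d_pt_polar.
  apply (Hc (r * cos t, r * sin t)). rewrite Cmod_polar; lra.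
- exists (r0 * cos t0, r0 * sin t0). split; [rewrite Cmod_polar; lra|].
  intros z Hz. destruct (polar z) as [t [Ht' E]]. rewrite E.
  apply Hm; [split; [apply Cmod_ge_0|exact Hz]|exact Ht'].
Qed.

Lemma is_cderive_continuity (f : C -> C) (z l : C) : is_cderive f z l ->
  continuity_2d_pt (fun x y => Re (f (x, y))) (Re z) (Im z) /\
  continuity_2d_pt (fun x y => Im (f (x, y))) (Re z) (Im z).
Proof.
intros H. rewrite (surjective_pairing z) in H.
apply is_cderive_differentiable_pt in H. destruct H as [H1 H2].
split; apply differentiable_continuity_pt; eexists; eexists; eassumption.
Qed.

Lemma Cmod2_continuity (f : C -> C) (z l : C) : is_cderive f z l ->
  continuity_2d_pt (fun x y => Cmod (f (x, y)) ^ 2) (Re z) (Im z).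
Proof.
intros H. destruct (is_cderive_continuity f z l H) as [H1 H2].
apply continuity_2d_pt_ext with (fun x y => Re (f (x, y)) * Re (f (x, y))
  + Im (f (x, y)) * Im (f (x, y))).
{ intros x y. rewrite Cmod2_alt. ring. }
now apply continuity_2d_pt_plus; apply continuity_2d_pt_mult.
Qed.

(** * Derivative tests at a maximum *)

Lemma is_derive_max_left (g : R -> R) (t0 l d : R) : is_derive g t0 l -> 0 < d ->
  (forall t, t0 - d < t < t0 -> g t <= g t0) -> 0 <= l.
Proof.
intros H Hd Hm. apply is_derive_Reals in H.
destruct (Rle_dec 0 l) as [|Hl]; [assumption|].
assert (Hl' : 0 < - l) by lra.
destruct (H _ Hl') as [e He].
set (h := Rmin e d / 2).
assert (Hh : 0 < h /\ h < e /\ h < d).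
{ pose proof (cond_pos e) as He0. unfold h, Rmin. destruct Rle_dec; lra. }
specialize (He (- h)). rewrite Rabs_Ropp, Rabs_pos_eq in He by lra.
specialize (He ltac:(lra) ltac:(lra)). apply Rabs_def2 in He.
specialize (Hm (t0 + - h) ltac:(lra)).
assert (0 <= (g (t0 + - h) - g t0) / - h).
{ replace ((g (t0 + - h) - g t0) / - h) with ((g t0 - g (t0 + - h)) / h)
    by (field; lra).
  apply Rdiv_le_0_compat; lra. }
lra.
Qed.

Lemma is_derive_max_right (g : R -> R) (t0 l d : R) : is_derive g t0 l -> 0 < d ->
  (forall t, t0 < t < t0 + d -> g t <= g t0) -> l <= 0.
Proof.
intros H Hd Hm.
cut (0 <= - l); [lra|].
apply (is_derive_max_left (fun t => g (- t)) (- t0) (- l) d); [|exact Hd|].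
- evar_last.
  + apply is_derive_comp with (f := g).
    * rewrite Ropp_involutive. exact H.
    * apply (is_derive_opp (V := R_NormedModule)). apply is_derive_id.
  + unfold scal, opp, one; simpl. unfold mult; simpl. ring.
- intros t Ht. rewrite Ropp_involutive. apply Hm. lra.
Qed.

(** The first derivative vanishes at 0; if [l] were positive, [g1] would be positive just to the
    right of 0, and the mean value theorem would give a value above [g 0]. *)
Lemma second_derivative_max (g g1 : R -> R) (l d : R) : 0 < d ->
  (forall t, Rabs t < d -> is_derive g t (g1 t)) -> is_derive g1 0 l ->
  (forall t, Rabs t < d -> g t <= g 0) -> l <= 0.
Proof.
intros Hd H1 H2 Hm.
assert (H0 : g1 0 = 0).
{ assert (K : is_derive g 0 (g1 0)) by (apply H1; rewrite Rabs_R0; exact Hd).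
  apply Rle_antisym.
  - apply (is_derive_max_right g 0 _ d K Hd). intros t Ht. apply Hm, Rabs_def1; lra.
  - apply (is_derive_max_left g 0 _ d K Hd). intros t Ht. apply Hm, Rabs_def1; lra. }
destruct (Rle_dec l 0) as [|Hl]; [assumption|]. apply Rnot_le_lt in Hl.
apply is_derive_Reals in H2. destruct (H2 _ Hl) as [e He].
set (h := Rmin e d / 2).
assert (Hh : 0 < h /\ h < e /\ h < d).
{ pose proof (cond_pos e) as He0. unfold h, Rmin. destruct Rle_dec; lra. }
destruct (MVT_cor2 g g1 0 h) as [c [Hc1 Hc2]]; [lra| |].
{ intros c Hc. apply is_derive_Reals, H1. apply Rabs_def1; lra. }
specialize (He c ltac:(lra)). rewrite Rplus_0_l, H0, Rabs_pos_eq in He by lra.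
specialize (He ltac:(lra)). apply Rabs_def2 in He.
specialize (Hm h). rewrite Rabs_pos_eq in Hm by lra. specialize (Hm ltac:(lra)).
assert (Hq : 0 < (g1 c - 0) / c) by lra.
assert (0 < g1 c).
{ replace (g1 c) with ((g1 c - 0) / c * c) by (field; lra).
  apply Rmult_lt_0_compat; lra. }
assert (0 < g1 c * (h - 0)) by (apply Rmult_lt_0_compat; lra).
lra.
Qed.

(** The left side is half the second derivative at [t = 0] of |f|^2 + e |z|^2 along the line z0 + t
    v, with [l] standing for f''(z0). *)
Lemma directional_second_derivative_max (f f1 : C -> C) (R0 e : R) (z0 v l : C) :
  (forall z, Cmod z < R0 -> is_cderive f z (f1 z)) ->
  is_cderive f1 z0 l ->
  Cmod z0 < R0 -> Cmod v = 1 ->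
  (forall z, Cmod z < R0 ->
    Cmod (f z) ^ 2 + e * Cmod z ^ 2 <= Cmod (f z0) ^ 2 + e * Cmod z0 ^ 2) ->
  Cmod (f1 z0) ^ 2 + Re (Cconj (f z0) * (l * v * v))%C + e <= 0.
Proof.
intros H1 H2 Hz0 Hv Hm.
pose (x t := Re z0 + t * Re v). pose (y t := Im z0 + t * Im v).
assert (Hx : forall t, is_derive x t (Re v)) by (intros t; unfold x; auto_derive; [trivial|ring]).
assert (Hy : forall t, is_derive y t (Im v)) by (intros t; unfold y; auto_derive; [trivial|ring]).
assert (Hxy : forall t, (x t, y t) = (z0 + RtoC t * v)%C).
{ intros t. unfold x, y, Cplus, Cmult, Re, Im; simpl. f_equal; ring. }
assert (Hin : forall t, Rabs t < R0 - Cmod z0 -> Cmod (x t, y t) < R0).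
{ intros t Ht. rewrite Hxy. eapply Rle_lt_trans; [apply Cmod_triangle|].
  rewrite Cmod_mult, Hv, Cmod_R. lra. }
assert (E0 : (x 0, y 0) = z0).
{ rewrite Hxy. change (@eq C (z0 + RtoC 0 * v)%C z0). ring. }
cut (2 * (Cmod (f1 z0) ^ 2 + Re (Cconj (f z0) * (l * v * v))%C + e) <= 0); [lra|].
assert (Hv2 : Re v * Re v + Im v * Im v = 1).
{ pose proof (Cmod2_alt v) as K. rewrite Hv in K. lra. }
apply (second_derivative_max
  (fun t => Cmod (f (x t, y t)) ^ 2 + e * Cmod (x t, y t) ^ 2)
  (fun t => 2 * Re (Cconj (f (x t, y t)) * (f1 (x t, y t) * v))%C
            + e * (2 * (Re (Cconj (x t, y t) * v)%C))) _ (R0 - Cmod z0)); [lra| | |].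
- intros t Ht. specialize (Hin t Ht).
  evar_last.
  + apply (is_derive_plus (V := R_NormedModule)).
    * apply (is_derive_Cmod2_curve f x y t (Re v) (Im v)); [apply H1, Hin|apply Hx|apply Hy].
    * apply is_derive_scal.
      apply (is_derive_Cmod2_curve (fun w => w) x y t (Re v) (Im v));
        [apply is_cderive_id|apply Hx|apply Hy].
  + unfold plus; simpl. unfold Re, Im; simpl. match goal with |- ?a = ?b => change (@eq R a b) end; ring.
- assert (Ha : Rabs 0 < R0 - Cmod z0) by (rewrite Rabs_R0; lra).
  specialize (Hin 0 Ha).
  evar_last.
  + apply (is_derive_plus (V := R_NormedModule)).
    * apply is_derive_scal.
      apply (is_derive_inner_curve f (fun w => f1 w * v)%C x y 0 (Re v) (Im v));
        [apply H1, Hin| |apply Hx|apply Hy].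
      apply is_cderive_mult; [rewrite E0; exact H2|apply is_cderive_const].
    * apply is_derive_scal. apply is_derive_scal.
      apply (is_derive_inner_curve (fun w => w) (fun _ => v) x y 0 (Re v) (Im v));
        [apply is_cderive_id|apply is_cderive_const|apply Hx|apply Hy].
  + rewrite E0. rewrite Cmod2_alt. unfold plus; simpl.
    match goal with |- ?a = ?b => change (@eq R a b) end.
    destruct v as [v1 v2], (f z0) as [a b], (f1 z0) as [p q], l as [p2 q2].
    unfold Re, Im in *; simpl in *.
    (* Inserting |v|^2 = 1 at two places makes both sides homogeneous in [v], and the goal becomes a
       polynomial identity. *)
    replace e with (e * (v1 * v1 + v2 * v2)) at 2 by (rewrite Hv2; ring).
    replace (p * (p * 1) + q * (q * 1)) with ((p * p + q * q) * (v1 * v1 + v2 * v2))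
      by (rewrite Hv2; ring).
    ring.
- intros t Ht. rewrite E0. apply Hm, Hin, Ht.
Qed.

(* At an interior maximum of [|f|^2 + e |z|^2] the Laplacian [4 |f'|^2 + 4 e] would be nonpositive. *)
Lemma maximum_modulus (f f1 : C -> C) (R0 K : R) : 0 < R0 -> 0 <= K ->
  (forall z, Cmod z <= R0 -> is_cderive f z (f1 z)) ->
  (forall z, Cmod z <= R0 -> exists l, is_cderive f1 z l) ->
  (forall z, Cmod z = R0 -> Cmod (f z) <= K) ->
  forall z, Cmod z <= R0 -> Cmod (f z) <= K.
Proof.
intros HR HK H1 H2 Hb z1 Hz1.
destruct (Rle_dec (Cmod (f z1)) K) as [|Hn]; [assumption|]. exfalso.
apply Rnot_le_lt in Hn.
(* With this [e], the perturbation adds at most half of the gap |f(z1)|^2 - K^2 on the disk, so a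
   maximum on the boundary circle is impossible. *)
set (e := (Cmod (f z1) ^ 2 - K ^ 2) / (2 * R0 ^ 2)).
assert (HR2 : 0 < R0 ^ 2) by (apply pow_lt; lra).
assert (Hd : 0 < Cmod (f z1) ^ 2 - K ^ 2) by nra.
assert (He : 0 < e) by (apply Rdiv_lt_0_compat; lra).
assert (HeR : e * R0 ^ 2 = (Cmod (f z1) ^ 2 - K ^ 2) / 2) by (unfold e; field; lra).
destruct (disk_max (fun z => Cmod (f z) ^ 2 + e * Cmod z ^ 2) R0) as [z0 [Hz0 Hm]]; [lra| |].
{ intros z Hz. apply continuity_2d_pt_plus.
  - exact (Cmod2_continuity f z _ (H1 z Hz)).
  - apply continuity_2d_pt_mult; [apply continuity_2d_pt_const|].
    exact (Cmod2_continuity (fun w => w) z _ (is_cderive_id z)). }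
destruct (Rle_lt_or_eq_dec _ _ Hz0) as [Hlt|Heq].
- destruct (H2 z0 Hz0) as [l Hl].
  assert (D : forall v, Cmod v = 1 ->
    Cmod (f1 z0) ^ 2 + Re (Cconj (f z0) * (l * v * v))%C + e <= 0).
  { intros v Hv. apply (directional_second_derivative_max f f1 R0); try assumption.
    - intros z Hz. apply H1. lra.
    - intros z Hz. apply Hm. lra. }
  (* In the directions 1 and i the terms with f'' have opposite signs; the sum of the two
     inequalities is |f'|^2 + e <= 0 up to a factor 2. *)
  pose proof (D 1%C Cmod_1) as D1. pose proof (D Ci Cmod_Ci) as D2.
  replace (l * 1 * 1)%C with (l) in D1 by ring.
  replace (l * Ci * Ci)%C with (- l)%C in D2.
  2:{ unfold Ci, Copp, Cmult; simpl. f_equal; ring. }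
  replace (Re (Cconj (f z0) * - l)%C) with (- Re (Cconj (f z0) * l)%C) in D2
    by (unfold Re; simpl; ring).
  pose proof (pow2_ge_0 (Cmod (f1 z0))). lra.
- specialize (Hm z1 Hz1). specialize (Hb z0 Heq). rewrite Heq in Hm.
  assert (Cmod (f z0) ^ 2 <= K ^ 2) by (apply pow_incr; split; [apply Cmod_ge_0|exact Hb]).
  pose proof (pow2_ge_0 (Cmod z1)).
  assert (0 <= e * Cmod z1 ^ 2) by (apply Rmult_le_pos; lra).
  lra.
Qed.

(** * The first touching point *)

(** The modulus of [z0] is the supremum [rho] of the radii, at most |z1|, of open disks on which [D]
    is positive. Continuity along radii gives [D >= 0] on the closed disk. Were [D] positive on the
    whole circle, compactness would push positivity past [rho]. *)
Lemma first_zero (D : C -> R) (z1 : C) :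
  (forall z, Cmod z < 1 -> continuity_2d_pt (fun x y => D (x, y)) (Re z) (Im z)) ->
  0 < D 0%C -> Cmod z1 < 1 -> D z1 <= 0 ->
  exists z0, 0 < Cmod z0 < 1 /\ D z0 = 0 /\
    forall z, Cmod z <= Cmod z0 -> 0 <= D z.
Proof.
intros Hc H0 Hz1 HD1. pose proof PI_RGT_0.
pose (E r := r <= Cmod z1 /\ forall z, Cmod z < r -> 0 < D z).
assert (E0 : E 0).
{ split; [apply Cmod_ge_0|]. intros z Hz. pose proof (Cmod_ge_0 z). lra. }
destruct (completeness E) as [rho [Hub Hlub]].
{ exists (Cmod z1). intros r [Hr _]. exact Hr. }
{ now exists 0. }
assert (Hrho0 : 0 <= rho) by now apply Hub.
assert (Hrho1 : rho <= Cmod z1) by (apply Hlub; intros r [Hr _]; exact Hr).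
assert (Hin : forall z, Cmod z < rho -> 0 < D z).
{ intros z Hz. destruct (classic (exists r, E r /\ Cmod z < r)) as [[r [[_ Hr] Hzr]]|Hn].
  - now apply Hr.
  - exfalso. apply (Rlt_not_le _ _ Hz). apply Hlub. intros r Hr.
    apply Rnot_lt_le. intros Hlt. apply Hn. now exists r. }
assert (Hpos : 0 < rho \/ rho = 0) by lra.
assert (Hcl : forall z, Cmod z <= rho -> 0 <= D z).
{ intros z Hz. destruct (Rle_dec 0 (D z)) as [|Hn]; [assumption|exfalso].
  assert (Hn' : 0 < - D z) by lra.
  destruct Hpos as [Hpos|Hpos].
  2:{ rewrite Hpos in Hz. rewrite (Cmod_eq_0 z) in Hn; [lra|].
      apply Rle_antisym; [exact Hz|apply Cmod_ge_0]. }
  destruct (Hc z ltac:(lra) (mkposreal _ Hn')) as [d Hd]. simpl in Hd.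
  pose proof (cond_pos d) as Hd0.
  (* The point (1 - q) z lies inside the open disk and within [d] of [z] in each coordinate, so [D]
     is positive there, against the continuity estimate at [z]. *)
  set (q := Rmin d 1 / 2).
  assert (Hq : 0 < q < 1 /\ q < d) by (unfold q, Rmin; destruct Rle_dec; lra).
  pose proof (Rmax_Cmod z) as Hm.
  pose proof (Rmax_l (Rabs (fst z)) (Rabs (snd z))) as Hm1.
  pose proof (Rmax_r (Rabs (fst z)) (Rabs (snd z))) as Hm2.
  assert (K : forall x, Rabs x <= 1 -> Rabs ((1 - q) * x - x) < d).
  { intros x Hx. replace ((1 - q) * x - x) with (- (q * x)) by ring.
    rewrite Rabs_Ropp, Rabs_mult, Rabs_pos_eq by lra.
    pose proof (Rabs_pos x). nra. }
  specialize (Hd ((1 - q) * Re z) ((1 - q) * Im z)).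
  specialize (Hd (K (Re z) ltac:(unfold Re; lra)) (K (Im z) ltac:(unfold Im; lra))).
  apply Rabs_def2 in Hd. unfold Re, Im in Hd. rewrite <- surjective_pairing in Hd.
  assert (Hq2 : 0 < D (((1 - q) * fst z)%R, ((1 - q) * snd z)%R)).
  { apply Hin. replace (((1 - q) * fst z)%R, ((1 - q) * snd z)%R)
      with (RtoC (1 - q) * z)%C
      by (unfold Cmult, RtoC; simpl; f_equal; ring).
    rewrite Cmod_mult, Cmod_R, Rabs_pos_eq by lra.
    pose proof (Cmod_ge_0 z). destruct (Rle_lt_or_eq_dec 0 (Cmod z)); nra. }
  lra. }
assert (Hz0 : exists z0, Cmod z0 = rho /\ D z0 <= 0).
{ apply NNPP. intros Hn.
  assert (Hcirc : forall z, Cmod z = rho -> 0 < D z).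
  { intros z Hz. apply Rnot_le_lt. intros Hle. apply Hn. now exists z. }
  pose (v r t := D (r * cos t, r * sin t)).
  assert (Hv : forall t, continuity_2d_pt v rho t).
  { intros t. apply continuity_2d_pt_polar.
    apply (Hc (rho * cos t, rho * sin t)). rewrite Cmod_polar; lra. }
  (* A rectangle degenerate in the radius: this yields the minimum of [D] on the circle of radius
     [rho]. *)
  destruct (rectangle_max (fun r t => - v r t) rho rho 0 (2 * PI))
    as [r0 [t0 [Hr0 [Ht0 Hm]]]]; [lra|lra| |].
  { intros r t Hr _. apply continuity_2d_pt_opp. replace r with rho by lra. apply Hv. }
  replace r0 with rho in Hm by lra.
  assert (Hmu : 0 < v rho t0) by (apply Hcirc, Cmod_polar; lra).
  destruct (uniform_continuity_2d_1d' v 0 (2 * PI) rho (fun t _ => Hv t) (mkposreal _ Hmu))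
    as [d Hd]. simpl in Hd. pose proof (cond_pos d) as Hd0.
  assert (Hext : forall z, Cmod z < rho + d -> 0 < D z).
  { intros z Hz. destruct (Rlt_le_dec (Cmod z) rho) as [Hlt|Hge]; [now apply Hin|].
    destruct (polar z) as [t [Ht Ez]]. rewrite Ez. fold (v (Cmod z) t).
    specialize (Hd t rho t (Cmod z) Ht ltac:(lra) Ht ltac:(lra)).
    rewrite Rminus_diag, Rabs_R0 in Hd. specialize (Hd Hd0). apply Rabs_def2 in Hd.
    specialize (Hm rho t ltac:(lra) Ht). simpl in Hm. lra. }
  (* If rho < |z1|, the collar of width [d] gives a larger admissible radius; otherwise [z1] itself
     lies on the circle, where [D] would be positive. *)
  destruct (Rle_lt_or_eq_dec _ _ Hrho1) as [Hlt|Heq].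
  - assert (K : E (Rmin (Cmod z1) (rho + d))).
    { split; [apply Rmin_l|]. intros z Hz. apply Hext.
      eapply Rlt_le_trans; [exact Hz|apply Rmin_r]. }
    apply Hub in K. unfold Rmin in K. destruct Rle_dec; lra.
  - specialize (Hcirc z1 (eq_sym Heq)). lra. }
destruct Hz0 as [z0 [Hz0 HD0]]. exists z0. rewrite Hz0.
split; [split; [|lra]|split; [|exact Hcl]].
- destruct Hpos as [|Hpos]; [assumption|]. exfalso.
  rewrite Hpos in Hz0. apply Cmod_eq_0 in Hz0. subst z0. lra.
- apply Rle_antisym; [exact HD0|]. apply Hcl. lra.
Qed.

(* [y] parametrizes the line [Re ((S + i n) (p + 1)) = 0], on which [p = (n + i S) y - 1]. *)
Lemma touching_point_normalized (S n s m u v p1 p2 : R) :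
  1 / 2 < S -> S ^ 2 + n ^ 2 = 1 -> 0 < m ->
  (s - 1) ^ 2 * n ^ 2 + (4 * S ^ 2 - 1) * (1 - 2 * s + m) <= 0 ->
  - 1 / 2 < u ->
  S * (p1 + 1) - n * p2 = 0 ->
  let N := p1 ^ 2 + p2 ^ 2 in
  let X1 := - 2 * S * (S * (m * u - s * p1) - n * (m * v - s * p2) + S * N + 2 * S * p1) in
  let X2 := - 2 * S * (S * (m * v - s * p2) + n * (m * u - s * p1) - n * N + 2 * S * p2) in
  X2 = 0 -> N <= X1 -> False.
Proof.
intros HS Hn Hm Hc Hu HD N X1 X2 HX2 HX1.
set (k := 4 * S ^ 2 - 1) in *.
assert (Hk : 0 < k) by (unfold k; nra).
set (y := p2 / S).
assert (E2 : p2 = S * y) by (unfold y; field; lra).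
assert (E1 : p1 = n * y - 1).
{ apply Rmult_eq_reg_l with S; [|lra]. rewrite E2 in HD. lra. }
assert (EN : N = y ^ 2 - 2 * n * y + 1).
{ unfold N. rewrite E1, E2. replace (y ^ 2) with ((S ^ 2 + n ^ 2) * y ^ 2) by (rewrite Hn; ring). ring. }
(* The combination is the real part of (S - i n)(X1 + i X2). It eliminates [v], about which nothing
   is known, and leaves only [u]. *)
assert (K : S * X1 + n * X2 = S * (- 2 * ((m * u - s * p1) * (S ^ 2 + n ^ 2)
  + (S ^ 2 - n ^ 2) * N + 2 * S * (S * p1 + n * p2)))) by (unfold X1, X2; ring).
rewrite HX2, Hn, Rmult_0_r, Rplus_0_r in K. apply Rmult_eq_reg_l in K; [|lra].
assert (Hn2 : n ^ 2 = 1 - S ^ 2) by lra.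
assert (HQ : m * u <= - (k / 2) * y ^ 2 + (s - 1) * n * y + (1 - 2 * s) / 2).
{ rewrite K, Hn2 in HX1.
  replace (S * p1 + n * p2) with (S * (2 * n * y - 1)) in HX1
    by (rewrite E1, E2; ring).
  rewrite EN, E1 in HX1. unfold k. nra. }
(* Completing the square: [k] times the quadratic, shifted by m/2, is half of minus a square plus
   the expression that [Hc] makes nonpositive. *)
assert (HQ2 : k * (- (k / 2) * y ^ 2 + (s - 1) * n * y + (1 - 2 * s + m) / 2) <= 0).
{ replace (k * (- (k / 2) * y ^ 2 + (s - 1) * n * y + (1 - 2 * s + m) / 2))
    with ((- (k * y - (s - 1) * n) ^ 2
           + ((s - 1) ^ 2 * n ^ 2 + k * (1 - 2 * s + m))) / 2) by field.
  pose proof (pow2_ge_0 (k * y - (s - 1) * n)). lra. }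
assert (HQ3 : - (k / 2) * y ^ 2 + (s - 1) * n * y + (1 - 2 * s + m) / 2 <= 0).
{ apply Rmult_le_reg_l with k; lra. }
assert (m * (- 1 / 2) < m * u) by (apply Rmult_lt_compat_l; lra).
lra.
Qed.

Lemma one_minus_neq_0 (z : C) : Cmod z < 1 -> (1 - z)%C <> 0.
Proof.
intros Hz E. assert (E' : z = 1%C).
{ replace z with (1 - (1 - z))%C by ring. rewrite E. ring. }
rewrite E', Cmod_1 in Hz. lra.
Qed.

(** The real part exceeds -1/2 by (1 - |z|^2) / (2 |1 - z|^2). *)
Lemma Re_half_plane (z : C) : Cmod z < 1 -> - 1 / 2 < Re (z / (1 - z))%C.
Proof.
intros Hz. pose proof (Cmod2_alt z) as H2. pose proof (Cmod_ge_0 z).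
destruct z as [x y]. unfold Re, Im in H2; simpl in H2.
assert (Hlt : x * x + y * y < 1) by nra.
unfold Cdiv, Cinv, Cmult, Cminus, Cplus, Copp, Re; simpl.
set (q := (1 + - x) * ((1 + - x) * 1) + (0 + - y) * ((0 + - y) * 1)).
assert (Hq : 0 < q) by (unfold q; nra).
apply Rmult_lt_reg_r with q; [exact Hq|].
replace ((x * ((1 + - x) / q) - y * (- (0 + - y) / q)) * q)
  with (x * (1 - x) - y * y) by (field; lra).
unfold q. nra.
Qed.

(* Here [H = z F'] and [T = z H'], and [A / B] is the Schwarz function of the half-plane;
   where [|A| = |B|] its logarithmic derivative times [z] is [X / |A|^2]. *)
Lemma touching_point (S n s m : R) (F H T z : C) :
  1 / 2 < S -> S ^ 2 + n ^ 2 = 1 -> 0 < m ->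
  (s - 1) ^ 2 * n ^ 2 + (4 * S ^ 2 - 1) * (1 - 2 * s + m) <= 0 ->
  Cmod z < 1 ->
  ((1 - z) * (T + RtoC s * H))%C = (RtoC m * z * F)%C ->
  Re ((S, n) * (H + F) * Cconj F)%C = 0 ->
  ~ (F = 0 /\ H = 0) ->
  let A := ((S, n) * H)%C in
  let B := (A + RtoC (2 * S) * F)%C in
  let X := (Cconj A * ((S, n) * T) - Cconj B * ((S, n) * T + RtoC (2 * S) * H))%C in
  Im X = 0 -> Cmod A ^ 2 <= Re X -> False.
Proof.
intros HS Hn Hm Hc Hz HT HD Hnz A B X HX2 HX1.
assert (HAm : Cmod A ^ 2 = Cmod H ^ 2).
{ unfold A. rewrite Cmod_mult, Rpow_mult_distr, (Cmod2_alt (S, n)). simpl.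
  replace (S * (S * 1) + n * (n * 1)) with (S ^ 2 + n ^ 2) by ring. rewrite Hn. ring. }
rewrite HAm in HX1. clear HAm.
pose proof (one_minus_neq_0 z Hz) as Hz1.
set (w := (z / (1 - z))%C).
assert (HTw : T = (RtoC m * w * F - RtoC s * H)%C).
{ replace T with (((1 - z) * (T + RtoC s * H)) / (1 - z) - RtoC s * H)%C by (field; exact Hz1).
  rewrite HT. unfold w. field. exact Hz1. }
destruct (Ceq_dec F 0) as [HF|HF].
(* At a zero of [F] one has A = B, and Re X is negative without recourse to the differential
   equation. *)
- assert (HH : H <> 0) by tauto. apply Cmod_gt_0 in HH.
  assert (E : Re X = - 2 * S ^ 2 * Cmod H ^ 2).
  { rewrite Cmod2_alt. unfold X, B, A. rewrite HF. unfold Re, Im; simpl. ring. }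
  rewrite E in HX1. assert (0 < Cmod H ^ 2) by now apply pow_lt. nra.
(* Here [p] is q - 1. All the relations are homogeneous in (F, H, T), so each is |F|^2 times its
   counterpart in [p] and [w]. *)
- set (p := (H / F)%C).
  assert (HH : H = (p * F)%C) by (unfold p; field; exact HF).
  assert (HN : 0 < Re F ^ 2 + Im F ^ 2).
  { rewrite <- Cmod2_alt. now apply pow_lt, Cmod_gt_0. }
  pose proof (Re_half_plane z Hz) as Hu. fold w in Hu.
  rewrite Cmod2_alt in HX1.
  unfold X, B, A in HX1, HX2. rewrite HTw, HH in HX1, HX2. rewrite HH in HD.
  clearbody w p. clear X B A HT HTw HH Hnz.
  destruct w as [u v], p as [p1 p2], F as [a b].
  unfold Re, Im in *; simpl in HX1, HX2, HD, HN, Hu.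
  assert (HN' : 0 < a ^ 2 + b ^ 2) by (simpl; lra).
  apply (touching_point_normalized S n s m u v p1 p2 HS Hn Hm Hc Hu).
  + apply Rmult_eq_reg_l with (a ^ 2 + b ^ 2); [|lra]. rewrite Rmult_0_r, <- HD. ring.
  + apply Rmult_eq_reg_l with (a ^ 2 + b ^ 2); [|lra]. rewrite Rmult_0_r, <- HX2. ring.
  + apply Rmult_le_reg_l with (a ^ 2 + b ^ 2); [exact HN'|].
    eapply Rle_trans; [|eapply Rle_trans; [exact HX1|]]; right; ring.
Qed.

(* [t^N (|F(t z)|^2 + |F1(t z)|^2)] is nondecreasing on (0,1] for large [N]. *)
Lemma ode_uniqueness (F F1 F2 : C -> C) (s m : R) (z0 : C) : 0 <= s -> 0 <= m ->
  (forall z, Cmod z < 1 -> is_cderive F z (F1 z)) ->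
  (forall z, Cmod z < 1 -> is_cderive F1 z (F2 z)) ->
  (forall z, Cmod z < 1 ->
    ((1 - z) * (F1 z + z * F2 z + RtoC s * F1 z))%C = (RtoC m * F z)%C) ->
  Cmod z0 < 1 -> F z0 = 0 -> F1 z0 = 0 -> F 0 = 0.
Proof.
intros Hs Hm H1 H2 Hode Hz0 HF HF1.
pose (x t := t * Re z0). pose (y t := t * Im z0).
assert (Hx : forall t, is_derive x t (Re z0)) by (intros t; unfold x; auto_derive; [trivial|ring]).
assert (Hy : forall t, is_derive y t (Im z0)) by (intros t; unfold y; auto_derive; [trivial|ring]).
assert (Hxy : forall t, (x t, y t) = (RtoC t * z0)%C).
{ intros t. unfold x, y, Cmult, Re, Im; simpl. f_equal; ring. }
pose proof (Cmod_ge_0 z0) as Hz00.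
assert (Hin : forall t, 0 <= t <= 1 -> Cmod (x t, y t) <= Cmod z0).
{ intros t Ht. rewrite Hxy, Cmod_mult, Cmod_R, Rabs_pos_eq by lra. nra. }
set (W := / (1 - Cmod z0)).
assert (HW : 0 < W) by (apply Rinv_0_lt_compat; lra).
(* This number bounds - t E'(t) / E(t): the term F' contributes 1, and the two terms of t F'' z0
   given by the equation contribute m W and 2 (1 + s). *)
destruct (INR_unbounded (1 + m * W + 2 * (1 + s))) as [N HN].
pose (E t := Cmod (F (x t, y t)) ^ 2 + Cmod (F1 (x t, y t)) ^ 2).
assert (HE : forall t, 0 <= E t).
{ intros t. apply Rplus_le_le_0_compat; apply pow2_ge_0. }
pose (E' t := 2 * Re (Cconj (F (x t, y t)) * (F1 (x t, y t) * z0))%C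
            + 2 * Re (Cconj (F1 (x t, y t)) * (F2 (x t, y t) * z0))%C).
assert (HdE : forall t, 0 <= t <= 1 -> is_derive E t (E' t)).
{ intros t Ht. specialize (Hin t Ht).
  assert (Hlt : Cmod (x t, y t) < 1) by lra.
  pose proof (is_derive_Cmod2_curve F x y t _ _ _ (H1 _ Hlt) (Hx t) (Hy t)) as D1.
  pose proof (is_derive_Cmod2_curve F1 x y t _ _ _ (H2 _ Hlt) (Hx t) (Hy t)) as D2.
  replace (Re z0, Im z0) with z0 in D1, D2 by apply surjective_pairing.
  exact (is_derive_plus (V := R_NormedModule) _ _ _ _ _ D1 D2). }
assert (HE' : forall t, 0 < t <= 1 -> 0 <= INR N * E t + t * E' t).
{ intros t Ht. specialize (Hin t ltac:(lra)).
  set (z := (x t, y t)) in *.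
  assert (Hz : (1 - z)%C <> 0) by (apply one_minus_neq_0; lra).
  assert (HWz : Cmod (/ (1 - z)) <= W).
  { rewrite Cmod_inv by exact Hz. apply Rinv_le_contravar; [lra|].
    pose proof (Cmod_triangle (1 - z) z) as Htr.
    replace (1 - z + z)%C with (RtoC 1) in Htr by ring. rewrite Cmod_1 in Htr. lra. }
  (* The equation is singular at 0 but determines z F'' without dividing by z. Since z = t z0, it
     controls t E' rather than E'. *)
  assert (HF2 : (RtoC t * (F2 z * z0))%C
    = (RtoC m * (F z * / (1 - z)) - RtoC (1 + s) * F1 z)%C).
  { assert (Ez : z = (RtoC t * z0)%C) by apply Hxy.
    specialize (Hode z ltac:(lra)).
    replace (RtoC t * (F2 z * z0))%C with (z * F2 z)%C by (rewrite Ez; ring).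
    replace (z * F2 z)%C with (((1 - z) * (F1 z + z * F2 z + RtoC s * F1 z)) / (1 - z)
      - (1 + RtoC s) * F1 z)%C by (field; exact Hz).
    rewrite Hode, RtoC_plus. field. exact Hz. }
  set (a := Cmod (F z)). set (b := Cmod (F1 z)).
  pose proof (Cmod_ge_0 (F z) : 0 <= a) as Ha.
  pose proof (Cmod_ge_0 (F1 z) : 0 <= b) as Hb.
  assert (Hre : forall c d : C, - (Cmod c * Cmod d) <= Re (Cconj c * d)%C).
  { intros c d. pose proof (re_le_Cmod (Cconj c * d)) as K.
    rewrite Cmod_mult, Cmod_conj in K. apply Rabs_le_between in K. lra. }
  assert (B1 : - (a * b) <= Re (Cconj (F z) * (F1 z * z0))%C).
  { eapply Rle_trans; [|apply Hre]. rewrite Cmod_mult. fold a b.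
    apply Ropp_le_contravar, Rmult_le_compat_l; [exact Ha|]. nra. }
  assert (B2 : - (m * W * (a * b)) - (1 + s) * b ^ 2
    <= t * Re (Cconj (F1 z) * (F2 z * z0))%C).
  { replace (t * Re (Cconj (F1 z) * (F2 z * z0))%C)
      with (Re (Cconj (F1 z) * (RtoC t * (F2 z * z0)))%C)
      by (unfold Re; simpl; ring).
    rewrite HF2.
    replace (Re (Cconj (F1 z) * (RtoC m * (F z * / (1 - z)) - RtoC (1 + s) * F1 z))%C)
      with (m * Re (Cconj (F1 z) * (F z * / (1 - z)))%C - (1 + s) * b ^ 2).
    2:{ unfold b. rewrite Cmod2_alt. generalize (/ (1 - z))%C as w. intros w.
        unfold Re, Im; simpl. ring. }
    apply Rplus_le_compat_r.
    replace (- (m * W * (a * b))) with (m * - (b * (a * W))) by ring.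
    apply Rmult_le_compat_l; [exact Hm|].
    eapply Rle_trans; [|apply Hre]. rewrite Cmod_mult. fold a b.
    apply Ropp_le_contravar, Rmult_le_compat_l; [exact Hb|].
    now apply Rmult_le_compat_l. }
  unfold E, E'. fold z a b.
  assert (B3 : 2 * (a * b) <= a ^ 2 + b ^ 2) by (pose proof (pow2_ge_0 (a - b)); nra).
  assert (B4 : t * (a * b) <= a * b) by (assert (0 <= a * b) by nra; nra).
  assert (B5 : - (a * b) <= t * Re (Cconj (F z) * (F1 z * z0))%C).
  { apply Rle_trans with (t * - (a * b)); [lra|]. apply Rmult_le_compat_l; lra. }
  assert (B6 : (1 + m * W + 2 * (1 + s)) * (a ^ 2 + b ^ 2) <= INR N * (a ^ 2 + b ^ 2)).
  { apply Rmult_le_compat_r; [|lra]. apply Rplus_le_le_0_compat; apply pow2_ge_0. }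
  assert (B7 : m * W * (2 * (a * b)) <= m * W * (a ^ 2 + b ^ 2)).
  { apply Rmult_le_compat_l; [apply Rmult_le_pos; lra|exact B3]. }
  assert (B8 : (1 + s) * b ^ 2 <= (1 + s) * (a ^ 2 + b ^ 2)).
  { apply Rmult_le_compat_l; [lra|]. pose proof (pow2_ge_0 a). lra. }
  lra. }
assert (HE0 : forall t, 0 < t < 1 -> E t = 0).
{ intros t Ht.
  (* The function r^N E(r) is nonnegative, has nonnegative derivative and vanishes at r = 1, hence
     vanishes on (0, 1); continuity of [E] then reaches 0. *)
  destruct (MVT_cor2 (fun r => r ^ N * E r)
    (fun r => INR N * r ^ pred N * E r + r ^ N * E' r) t 1) as [c [Hc1 Hc2]]; [lra| |].
  { intros c Hc. apply is_derive_Reals.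
    evar_last.
    - apply (is_derive_mult (K := R_AbsRing));
        [apply is_derive_pow, is_derive_id|apply HdE; lra|apply Rmult_comm].
    - unfold plus, mult, one; simpl. match goal with |- ?p = ?q => change (@eq R p q) end; ring. }
  assert (E1 : E 1 = 0).
  { unfold E. rewrite Hxy, Cmult_1_l, HF, HF1, Cmod_0. ring. }
  rewrite E1, Rmult_0_r in Hc1.
  assert (Hd : 0 <= INR N * c ^ pred N * E c + c ^ N * E' c).
  { specialize (HE' c ltac:(lra)). destruct N as [|N']; [simpl; simpl in HE'; nra|].
    simpl pred. replace (c ^ S N') with (c ^ N' * c) by (simpl; ring).
    replace (INR (S N') * c ^ N' * E c + c ^ N' * c * E' c)
      with (c ^ N' * (INR (S N') * E c + c * E' c)) by ring.
    apply Rmult_le_pos; [|exact HE']. apply pow_le; lra. }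
  assert (Hp : 0 < t ^ N) by (apply pow_lt; lra).
  assert (0 <= (INR N * c ^ pred N * E c + c ^ N * E' c) * (1 - t))
    by (apply Rmult_le_pos; lra).
  apply Rle_antisym; [|apply HE].
  apply Rmult_le_reg_l with (t ^ N); [exact Hp|]. lra. }
apply Cmod_eq_0. apply NNPP. intros Hn.
assert (Hpos : 0 < E 0).
{ unfold E. rewrite Hxy. replace (RtoC 0 * z0)%C with (RtoC 0) by ring.
  pose proof (pow2_ge_0 (Cmod (F1 0))).
  assert (0 < Cmod (F 0) ^ 2).
  { apply pow_lt. pose proof (Cmod_ge_0 (F 0)). lra. }
  lra. }
assert (HcE : continuity_pt E 0).
{ apply derivable_continuous_pt. exists (E' 0). apply is_derive_Reals, HdE. lra. }
apply continuity_pt_locally with (eps := mkposreal _ Hpos) in HcE.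
destruct HcE as [d Hd]. simpl in Hd. pose proof (cond_pos d) as Hd0.
set (t := Rmin d 1 / 2).
assert (Ht : 0 < t < 1 /\ t < d) by (unfold t, Rmin; destruct Rle_dec; lra).
specialize (Hd t). rewrite HE0 in Hd by lra.
assert (K : Rabs (0 - E 0) < E 0).
{ apply Hd. change (Rabs (t - 0) < d). rewrite Rminus_0_r, Rabs_pos_eq; lra. }
rewrite Rminus_0_l, Rabs_Ropp, Rabs_pos_eq in K; lra.
Qed.

(** * Jack's lemma on one half-plane *)

Lemma half_plane (F F1 F2 F3 : C -> C) (s m S n : R) :
  1 / 2 < S -> S ^ 2 + n ^ 2 = 1 -> 0 <= s -> 0 < m ->
  (s - 1) ^ 2 * n ^ 2 + (4 * S ^ 2 - 1) * (1 - 2 * s + m) <= 0 ->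
  (forall z, Cmod z < 1 -> is_cderive F z (F1 z)) ->
  (forall z, Cmod z < 1 -> is_cderive F1 z (F2 z)) ->
  (forall z, Cmod z < 1 -> is_cderive F2 z (F3 z)) ->
  (forall z, Cmod z < 1 ->
    ((1 - z) * (F1 z + z * F2 z + RtoC s * F1 z))%C = (RtoC m * F z)%C) ->
  F 0 = 1 ->
  forall z, Cmod z < 1 -> 0 < Re ((S, n) * (z * F1 z + F z) * Cconj (F z))%C.
Proof.
intros HS Hn Hs Hm Hc H1 H2 H3 Hode HF0 z1 Hz1.
apply Rnot_le_lt. intros HD1.
(* [D] is Re (eps q) |F|^2, which stays meaningful at zeros of [F]. *)
set (D z := Re ((S, n) * (z * F1 z + F z) * Cconj (F z))%C) in *.
set (eps := (S, n) : C) in *.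
pose (A z := (eps * (z * F1 z))%C).
pose (B z := (A z + RtoC (2 * S) * F z)%C).
pose (A1 z := (eps * (F1 z + z * F2 z))%C).
pose (B1 z := (A1 z + RtoC (2 * S) * F1 z)%C).
assert (HA : forall z, Cmod z < 1 -> is_cderive A z (A1 z)).
{ intros z Hz. eapply is_cderive_eq.
  - apply is_cderive_mult; [apply is_cderive_const|].
    apply is_cderive_mult; [apply is_cderive_id|apply H2, Hz].
  - unfold A1. ring. }
assert (HB : forall z, Cmod z < 1 -> is_cderive B z (B1 z)).
{ intros z Hz. eapply is_cderive_eq.
  - apply is_cderive_plus; [apply HA, Hz|].
    apply is_cderive_mult; [apply is_cderive_const|apply H1, Hz].
  - unfold B1. ring. }
assert (HA1 : forall z, Cmod z < 1 -> exists l, is_cderive A1 z l).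
{ intros z Hz. eexists.
  apply is_cderive_mult; [apply is_cderive_const|].
  apply is_cderive_plus; [apply H2, Hz|].
  apply is_cderive_mult; [apply is_cderive_id|apply H3, Hz]. }
assert (HB1 : forall z, Cmod z < 1 -> exists l, is_cderive B1 z l).
{ intros z Hz. destruct (HA1 z Hz) as [l Hl]. eexists.
  apply is_cderive_plus; [exact Hl|].
  apply is_cderive_mult; [apply is_cderive_const|apply H2, Hz]. }
(* Thus the sign of [D] compares |A| with |B|, and the boundary line of the half-plane corresponds
   to |A| = |B|. *)
assert (HD : forall z, Cmod (B z) ^ 2 - Cmod (A z) ^ 2 = 4 * S * D z).
{ intros z. rewrite !Cmod2_alt. unfold B, A, D, eps.
  generalize (z * F1 z)%C (F z). intros h f. unfold Re, Im; simpl. ring. }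
destruct (first_zero D z1) as [z0 [Hz0 [HD0 Hle]]]; [| |exact Hz1|exact HD1|].
{ intros z Hz.
  apply continuity_2d_pt_ext with
    (fun x y => / (4 * S) * (Cmod (B (x, y)) ^ 2 - Cmod (A (x, y)) ^ 2)).
  { intros x y. rewrite HD. field. lra. }
  apply continuity_2d_pt_mult; [apply continuity_2d_pt_const|].
  apply continuity_2d_pt_minus;
    [exact (Cmod2_continuity B z _ (HB z Hz))|exact (Cmod2_continuity A z _ (HA z Hz))]. }
{ unfold D, eps. rewrite HF0. unfold Re; simpl. lra. }
set (rho := Cmod z0) in *.
assert (HAB : forall z, Cmod z <= rho -> Cmod (A z) <= Cmod (B z)).
{ intros z Hz. specialize (Hle z Hz). specialize (HD z).
  assert (0 <= 4 * S * D z) by (apply Rmult_le_pos; lra).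
  apply Rsqr_incr_0; [unfold Rsqr; lra|apply Cmod_ge_0|apply Cmod_ge_0]. }
assert (Heps : eps <> 0) by (intros K; injection K; lra).
assert (H2S : RtoC (2 * S) <> 0) by (intros K; injection K; lra).
(* A zero of [B] in this disk is a common zero of [A] and [B], hence of F and z F'. Away from 0,
   uniqueness for the equation contradicts F(0) = 1; at 0 the value of [F] alone does. *)
assert (HBz : forall z, Cmod z <= rho -> B z <> 0).
{ intros z Hz HBz. pose proof (HAB z Hz) as K. rewrite HBz, Cmod_0 in K.
  assert (HAz : A z = 0) by (apply Cmod_eq_0, Rle_antisym; [exact K|apply Cmod_ge_0]).
  assert (HFz : F z = 0).
  { replace (F z) with ((B z - A z) / RtoC (2 * S))%C.
    - rewrite HBz, HAz. field. exact H2S.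
    - unfold B. field. exact H2S. }
  destruct (Ceq_dec z 0) as [E|E].
  - rewrite E, HF0 in HFz. injection HFz. lra.
  - assert (HF1z : F1 z = 0).
    { replace (F1 z) with (A z / (eps * z))%C by (unfold A; field; split; assumption).
      rewrite HAz. field. split; assumption. }
    assert (Hz' : Cmod z < 1) by lra.
    pose proof (ode_uniqueness F F1 F2 s m z Hs (Rlt_le _ _ Hm) H1 H2 Hode Hz' HFz HF1z) as K'.
    rewrite HF0 in K'. injection K'. lra. }
(* Schwarz lemma: [psi] is A/(z B) with the factor z of [A] cancelled, so it is holomorphic at 0
   too. On the circle |z| = rho its modulus is at most 1/rho, and so inside. *)
pose (psi z := (eps * F1 z * / B z)%C).
pose (psi1 z := (eps * F2 z * / B z + eps * F1 z * (- B1 z / (B z * B z)))%C).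
assert (Hpsi : forall z, Cmod z <= rho -> Cmod (psi z) <= / rho).
{ apply (maximum_modulus psi psi1); [lra| | | |].
  - apply Rlt_le, Rinv_0_lt_compat. lra.
  - intros z Hz. assert (Hz' : Cmod z < 1) by lra. eapply is_cderive_eq.
    + apply is_cderive_mult.
      * apply is_cderive_mult; [apply is_cderive_const|apply H2, Hz'].
      * apply is_cderive_inv; [apply HB, Hz'|apply HBz, Hz].
    + unfold psi1. ring.
  - intros z Hz. assert (Hz' : Cmod z < 1) by lra.
    destruct (HB1 z Hz') as [l Hl].
    assert (HiB : is_cderive (fun w => / B w)%C z (- B1 z / (B z * B z))%C)
      by (apply is_cderive_inv; [apply HB, Hz'|apply HBz, Hz]).
    eexists. apply is_cderive_plus.
    + apply is_cderive_mult; [|exact HiB].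
      apply is_cderive_mult; [apply is_cderive_const|apply H3, Hz'].
    + apply is_cderive_mult.
      * apply is_cderive_mult; [apply is_cderive_const|apply H2, Hz'].
      * unfold Cdiv. apply is_cderive_mult.
        -- apply is_cderive_opp, Hl.
        -- apply is_cderive_inv; [|apply Cmult_neq_0; apply HBz, Hz].
           apply is_cderive_mult; apply HB, Hz'.
  - intros z Hz. pose proof (HAB z ltac:(lra)) as K.
    assert (HBp : 0 < Cmod (B z)) by (apply Cmod_gt_0, HBz; lra).
    unfold psi. rewrite Cmod_mult, Cmod_inv by (apply HBz; lra).
    apply Rmult_le_reg_r with (Cmod (B z) * rho); [apply Rmult_lt_0_compat; lra|].
    unfold A in K. rewrite !Cmod_mult in *. rewrite Hz in K.
    replace (Cmod eps * Cmod (F1 z) * / Cmod (B z) * (Cmod (B z) * rho))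
      with (Cmod eps * (rho * Cmod (F1 z))) by (field; lra).
    replace (/ rho * (Cmod (B z) * rho)) with (Cmod (B z)) by (field; lra).
    exact K. }
assert (HAr : forall z, Cmod z <= rho -> rho * Cmod (A z) <= Cmod z * Cmod (B z)).
{ intros z Hz. pose proof (Hpsi z Hz) as K. unfold psi in K.
  assert (HBp : 0 < Cmod (B z)) by (apply Cmod_gt_0, HBz, Hz).
  rewrite Cmod_mult, Cmod_inv in K by (apply HBz; lra).
  apply (Rmult_le_compat_r (Cmod (B z) * rho * Cmod z)) in K.
  2:{ repeat apply Rmult_le_pos; apply Cmod_ge_0. }
  replace (/ rho * (Cmod (B z) * rho * Cmod z)) with (Cmod z * Cmod (B z)) in K
    by (field; lra).
  eapply Rle_trans; [|exact K]. right. unfold A. rewrite !Cmod_mult. field; lra. }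
assert (Hz0' : Cmod z0 < 1) by (fold rho; lra).
assert (HAB0 : Cmod (A z0) ^ 2 = Cmod (B z0) ^ 2).
{ specialize (HD z0). rewrite HD0 in HD. lra. }
(* Real part of Jack's lemma. Along the radius, |A(t z0)|^2 - t^2 |B(t z0)|^2 is at most 0 for t < 1
   and equals 0 at t = 1, so its derivative there is nonnegative. *)
assert (Hrad : 0 <= Re (Cconj (A z0) * (A1 z0 * z0))%C - Re (Cconj (B z0) * (B1 z0 * z0))%C
    - Cmod (B z0) ^ 2).
{ pose (x t := t * Re z0). pose (y t := t * Im z0).
  assert (Hx : is_derive x 1 (Re z0)) by (unfold x; auto_derive; [trivial|ring]).
  assert (Hy : is_derive y 1 (Im z0)) by (unfold y; auto_derive; [trivial|ring]).
  assert (Hxy : forall t, (x t, y t) = (RtoC t * z0)%C).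
  { intros t. unfold x, y, Cmult, Re, Im; simpl. f_equal; ring. }
  assert (E1 : (x 1, y 1) = z0) by (rewrite Hxy; apply Cmult_1_l).
  assert (DA := is_derive_Cmod2_curve A x y 1 _ _ (A1 z0)
    ltac:(rewrite E1; apply HA, Hz0') Hx Hy).
  assert (DB := is_derive_Cmod2_curve B x y 1 _ _ (B1 z0)
    ltac:(rewrite E1; apply HB, Hz0') Hx Hy).
  rewrite E1 in DA, DB. replace (Re z0, Im z0) with z0 in DA, DB by apply surjective_pairing.
  cut (0 <= 2 * (Re (Cconj (A z0) * (A1 z0 * z0))%C - Re (Cconj (B z0) * (B1 z0 * z0))%C
    - Cmod (B z0) ^ 2)); [lra|].
  apply (is_derive_max_left
    (fun t => Cmod (A (x t, y t)) ^ 2 - t ^ 2 * Cmod (B (x t, y t)) ^ 2) 1 _ 1); [|lra|].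
  - evar_last.
    + apply (is_derive_minus (V := R_NormedModule)); [exact DA|].
      apply (is_derive_mult (K := R_AbsRing));
        [apply is_derive_pow, is_derive_id|exact DB|apply Rmult_comm].
    + cbv beta. rewrite E1. unfold minus, plus, opp, mult, one; simpl.
      match goal with |- ?p = ?q => change (@eq R p q) end; ring.
  - intros t Ht. rewrite E1, HAB0.
    specialize (HAr (x t, y t)). rewrite Hxy in *.
    rewrite Cmod_mult, Cmod_R, Rabs_pos_eq in HAr by lra. fold rho in HAr.
    specialize (HAr ltac:(nra)).
    set (a := Cmod (A (RtoC t * z0)%C)) in *. set (b := Cmod (B (RtoC t * z0)%C)) in *.
    assert (Hab : a <= t * b) by (apply Rmult_le_reg_l with rho; lra).
    assert (a ^ 2 <= (t * b) ^ 2)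
      by (apply pow_incr; split; [apply Cmod_ge_0|exact Hab]).
    rewrite Rpow_mult_distr in H. lra. }
(* Imaginary part of Jack's lemma. On the circle |z| = rho, |A|^2 - |B|^2 is maximal at z0, so its
   derivative under the rotation of z0 by the angle t vanishes at t = 0. *)
assert (Hang : Re (Cconj (A z0) * (A1 z0 * (Ci * z0)))%C
             - Re (Cconj (B z0) * (B1 z0 * (Ci * z0)))%C = 0).
{ pose (x t := Re z0 * cos t - Im z0 * sin t).
  pose (y t := Re z0 * sin t + Im z0 * cos t).
  assert (Hx : is_derive x 0 (- Im z0)).
  { unfold x. auto_derive; [trivial|]. rewrite sin_0, cos_0. ring. }
  assert (Hy : is_derive y 0 (Re z0)).
  { unfold y. auto_derive; [trivial|]. rewrite sin_0, cos_0. ring. }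
  assert (E0 : (x 0, y 0) = z0).
  { unfold x, y. rewrite sin_0, cos_0. rewrite (surjective_pairing z0).
    unfold Re, Im; simpl. f_equal; ring. }
  assert (EC : (- Im z0, Re z0) = (Ci * z0)%C).
  { unfold Ci, Cmult, Re, Im; simpl. f_equal; ring. }
  assert (Hmod : forall t, Cmod (x t, y t) = rho).
  { intros t. unfold rho, Cmod, x, y, Re, Im; simpl. f_equal.
    replace (fst z0 * (fst z0 * 1) + snd z0 * (snd z0 * 1))
      with ((fst z0 * fst z0 + snd z0 * snd z0) * ((sin t)² + (cos t)²))
      by (rewrite sin2_cos2; ring).
    unfold Rsqr. ring. }
  assert (DA := is_derive_Cmod2_curve A x y 0 _ _ (A1 z0)
    ltac:(rewrite E0; apply HA, Hz0') Hx Hy).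
  assert (DB := is_derive_Cmod2_curve B x y 0 _ _ (B1 z0)
    ltac:(rewrite E0; apply HB, Hz0') Hx Hy).
  rewrite E0, EC in DA, DB.
  assert (DAB := is_derive_minus (V := R_NormedModule) _ _ _ _ _ DA DB).
  assert (Hmax : forall t, minus (Cmod (A (x t, y t)) ^ 2) (Cmod (B (x t, y t)) ^ 2)
    <= minus (Cmod (A (x 0, y 0)) ^ 2) (Cmod (B (x 0, y 0)) ^ 2)).
  { intros t. rewrite E0, HAB0. unfold minus, plus, opp; simpl.
    specialize (HAB (x t, y t) ltac:(rewrite Hmod; lra)).
    assert (Cmod (A (x t, y t)) ^ 2 <= Cmod (B (x t, y t)) ^ 2)
      by (apply pow_incr; split; [apply Cmod_ge_0|exact HAB]).
    simpl in H. lra. }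
  assert (K1 := is_derive_max_left _ 0 _ 1 DAB ltac:(lra) (fun t _ => Hmax t)).
  assert (K2 := is_derive_max_right _ 0 _ 1 DAB ltac:(lra) (fun t _ => Hmax t)).
  unfold minus, plus, opp in K1, K2; simpl in K1, K2.
  simpl. lra. }
pose (H := (z0 * F1 z0)%C).
pose (T := (z0 * (F1 z0 + z0 * F2 z0))%C).
apply (touching_point S n s m (F z0) H T z0 HS Hn Hm Hc Hz0').
- unfold H, T. rewrite <- Cmult_assoc.
  replace (RtoC m * (z0 * F z0))%C with (z0 * (RtoC m * F z0))%C by ring.
  rewrite <- Hode by exact Hz0'. ring.
- exact HD0.
- intros [EF EH]. apply (HBz z0 (Rle_refl _)). unfold B, A. fold H. rewrite EF, EH. ring.
(* The factor i in the tangential derivative turns a real part into minus an imaginary part. *)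
- replace (Im _) with (- (Re (Cconj (A z0) * (A1 z0 * (Ci * z0)))%C
             - Re (Cconj (B z0) * (B1 z0 * (Ci * z0)))%C)); [lra|].
  unfold A1, B1, B, A1, A, T, H, eps, Re, Im, Ci; simpl. ring.
- fold eps H. change (eps * H)%C with (A z0). rewrite HAB0.
  replace (Re _) with (Re (Cconj (A z0) * (A1 z0 * z0))%C
     - Re (Cconj (B z0) * (B1 z0 * z0))%C); [lra|].
  unfold B1, B, A1, A, T, H, eps, Re, Im; simpl. ring.
Qed.

(** * Power series *)

(** [CPSeries a z] unfolds to [csum] of its terms, so [change] passes between the two, and the
    algebra of sums is proved once for arbitrary complex terms. *)
Definition csum (u : nat -> C) : C :=
  (Series (fun n => Re (u n)), Series (fun n => Im (u n))).

Definition abs_summable (u : nat -> C) : Prop := ex_series (fun n => Cmod (u n)).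

Lemma abs_summable_ext (u v : nat -> C) :
  (forall n, u n = v n) -> abs_summable u -> abs_summable v.
Proof. intros H. apply ex_series_ext. intros n. now rewrite H. Qed.

Lemma abs_summable_plus (u v : nat -> C) :
  abs_summable u -> abs_summable v -> abs_summable (fun n => u n + v n)%C.
Proof.
intros Hu Hv.
apply (ex_series_le (V := R_CompleteNormedModule)) with (fun n => Cmod (u n) + Cmod (v n)).
- intros n. change (Rabs (Cmod (u n + v n)%C) <= Cmod (u n) + Cmod (v n)).
  rewrite Rabs_pos_eq by apply Cmod_ge_0. apply Cmod_triangle.
- now apply (ex_series_plus (V := R_NormedModule)).
Qed.

Lemma abs_summable_scal (c : C) (u : nat -> C) :
  abs_summable u -> abs_summable (fun n => c * u n)%C.
Proof.
intros Hu. apply ex_series_ext with (fun n => Cmod c * Cmod (u n)).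
- intros n. now rewrite Cmod_mult.
- now apply (ex_series_scal (V := R_NormedModule) (Cmod c)).
Qed.

Lemma abs_summable_incr_1 (u : nat -> C) :
  abs_summable u <-> abs_summable (fun n => u (S n)).
Proof. apply (ex_series_incr_1 (V := R_NormedModule)). Qed.

Lemma abs_summable_Re_Im (u : nat -> C) : abs_summable u ->
  ex_series (fun n => Rabs (Re (u n))) /\ ex_series (fun n => Rabs (Im (u n))).
Proof.
intros Hu. split; apply (ex_series_le (V := R_CompleteNormedModule)) with (2 := Hu);
  intros n; (eapply Rle_trans; [|apply Rmax_Cmod]).
- change (Rabs (Rabs (Re (u n))) <= Rmax (Rabs (Re (u n))) (Rabs (Im (u n)))).
  rewrite Rabs_Rabsolu. apply Rmax_l.
- change (Rabs (Rabs (Im (u n))) <= Rmax (Rabs (Re (u n))) (Rabs (Im (u n)))).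
  rewrite Rabs_Rabsolu. apply Rmax_r.
Qed.

Lemma csum_ext (u v : nat -> C) : (forall n, u n = v n) -> csum u = csum v.
Proof. intros H. unfold csum. f_equal; apply Series_ext; intros n; now rewrite H. Qed.

Lemma csum_plus (u v : nat -> C) : abs_summable u -> abs_summable v ->
  csum (fun n => u n + v n)%C = (csum u + csum v)%C.
Proof.
intros Hu Hv. apply abs_summable_Re_Im in Hu. apply abs_summable_Re_Im in Hv.
destruct Hu, Hv. unfold csum, Cplus at 3. simpl.
f_equal; apply Series_plus; now apply ex_series_Rabs.
Qed.

Lemma csum_scal (c : C) (u : nat -> C) : abs_summable u ->
  csum (fun n => c * u n)%C = (c * csum u)%C.
Proof.
intros Hu. apply abs_summable_Re_Im in Hu. destruct Hu as [H1 H2].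
apply ex_series_Rabs in H1. apply ex_series_Rabs in H2.
unfold csum, Cmult at 3. simpl. rewrite <- !Series_scal_l.
f_equal.
- rewrite <- Series_minus by (apply (ex_series_scal (V := R_NormedModule)); assumption). reflexivity.
- rewrite <- Series_plus by (apply (ex_series_scal (V := R_NormedModule)); assumption). reflexivity.
Qed.

Lemma csum_incr_1 (u : nat -> C) : abs_summable u ->
  csum u = (u O + csum (fun n => u (S n)))%C.
Proof.
intros Hu. apply abs_summable_Re_Im in Hu. destruct Hu as [H1 H2].
apply ex_series_Rabs in H1. apply ex_series_Rabs in H2.
unfold csum, Cplus. simpl. rewrite Series_incr_1 by exact H1.
now rewrite (Series_incr_1 (fun n => Im (u n))) by exact H2.
Qed.

(** The factor 2 comes from estimating real and imaginary parts separately; a bound with some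
    constant is enough for differentiation. *)
Lemma Cmod_csum_le (u : nat -> C) (b : nat -> R) : (forall n, Cmod (u n) <= b n) ->
  ex_series b -> Cmod (csum u) <= 2 * Series b.
Proof.
intros H Hb.
assert (K : forall x : nat -> R, (forall n, Rabs (x n) <= b n) -> Rabs (Series x) <= Series b).
{ intros x Hx.
  assert (Hex : ex_series (fun n => Rabs (x n))).
  { apply (ex_series_le (V := R_CompleteNormedModule)) with (2 := Hb). intros n.
    change (Rabs (Rabs (x n)) <= b n). rewrite Rabs_Rabsolu. apply Hx. }
  eapply Rle_trans; [now apply Series_Rabs|]. apply Series_le; [|exact Hb].
  intros n. split; [apply Rabs_pos|apply Hx]. }
assert (K1 : Rabs (Series (fun n => Re (u n))) <= Series b).
{ apply K. intros n. eapply Rle_trans; [apply re_le_Cmod|apply H]. }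
assert (K2 : Rabs (Series (fun n => Im (u n))) <= Series b).
{ apply K. intros n. eapply Rle_trans; [|apply H]. eapply Rle_trans; [|apply Rmax_Cmod].
  apply Rmax_r. }
replace (csum u) with (RtoC (Series (fun n => Re (u n))) + Ci * RtoC (Series (fun n => Im (u n))))%C.
2:{ unfold csum, Ci, RtoC, Cplus, Cmult; simpl. f_equal; ring. }
eapply Rle_trans; [apply Cmod_triangle|].
rewrite Cmod_mult, Cmod_Ci, !Cmod_R. lra.
Qed.

Lemma abs_summable_pseries (A : nat -> R) (z : C) : Rbar_le 1 (CV_radius A) ->
  Cmod z < 1 -> abs_summable (fun n => RtoC (A n) * z ^ n)%C.
Proof.
intros HA Hz. apply ex_series_ext with (fun n => Rabs (A n * Cmod z ^ n)).
- intros n. rewrite Cmod_mult, Cmod_R, Cmod_pow, Rabs_mult.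
  now rewrite (Rabs_pos_eq (Cmod z ^ n)) by (apply pow_le, Cmod_ge_0).
- apply CV_disk_inside. eapply Rbar_lt_le_trans; [|exact HA].
  simpl. rewrite Rabs_pos_eq; [exact Hz|apply Cmod_ge_0].
Qed.

(** Second-order Taylor remainder of a power. Multiplying the remainder for one exponent by z + h
    gives the next one up to a term in h^2. The constant omits Taylor's factor 1/2 and is exactly
    the one that two applications of [PS_derive] produce. *)
Lemma pow_increment_bound (z h : C) (r : R) (n : nat) :
  Cmod z <= r -> Cmod (z + h)%C <= r ->
  Cmod ((z + h) ^ S (S n) - z ^ S (S n) - RtoC (INR (S (S n))) * z ^ S n * h)%C
    <= INR (S n) * INR (S (S n)) * r ^ n * Cmod h ^ 2.
Proof.
intros Hz Hzh. pose proof (Cmod_ge_0 z) as Hz0. pose proof (Cmod_ge_0 h) as Hh0.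
assert (Hr : 0 <= r) by lra.
induction n as [|n IH].
- replace ((z + h) ^ 2 - z ^ 2 - RtoC (INR 2) * z ^ 1 * h)%C with (h * h)%C.
  + rewrite Cmod_mult. simpl. nra.
  + replace (INR 2) with 2 by (simpl; ring).
    replace (RtoC 2) with (1 + 1)%C by (unfold RtoC, Cplus; simpl; f_equal; ring).
    simpl. ring.
- set (m := S n) in *.
  replace ((z + h) ^ S (S m) - z ^ S (S m) - RtoC (INR (S (S m))) * z ^ S m * h)%C
    with ((z + h) * ((z + h) ^ S m - z ^ S m - RtoC (INR (S m)) * z ^ m * h)
          + RtoC (INR (S m)) * z ^ m * (h * h))%C.
  2:{ rewrite (S_INR (S m)), RtoC_plus. simpl. ring. }
  eapply Rle_trans; [apply Cmod_triangle|]. rewrite !Cmod_mult, Cmod_R, Cmod_pow.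
  rewrite (Rabs_pos_eq (INR (S m))) by apply pos_INR.
  assert (K1 : Cmod (z + h) * Cmod ((z + h) ^ S m - z ^ S m - RtoC (INR (S m)) * z ^ m * h)%C
    <= r * (INR m * INR (S m) * r ^ n * Cmod h ^ 2)).
  { apply Rmult_le_compat; try apply Cmod_ge_0; assumption. }
  assert (K2 : INR (S m) * Cmod z ^ m * (Cmod h * Cmod h) <= INR (S m) * r ^ m * Cmod h ^ 2).
  { replace (Cmod h * Cmod h) with (Cmod h ^ 2) by ring.
    apply Rmult_le_compat_r; [apply pow2_ge_0|].
    apply Rmult_le_compat_l; [apply pos_INR|]. apply pow_incr. lra. }
  eapply Rle_trans; [apply Rplus_le_compat; [exact K1|exact K2]|].
  assert (K3 : 0 <= INR (S m) * r ^ m * Cmod h ^ 2).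
  { apply Rmult_le_pos; [|apply pow2_ge_0]. apply Rmult_le_pos; [apply pos_INR|].
    now apply pow_le. }
  rewrite (S_INR (S m)), (S_INR m) in *. unfold m in *. simpl pow in *.
  pose proof (pos_INR (S n)). nra.
Qed.

(** Termwise differentiation: the remainders sum to at most 2 |h|^2 times the absolutely convergent
    series of second derivatives at a radius [r] strictly between |z| and 1. Real coefficients make
    the real theory of [CV_radius] available. *)
Lemma is_cderive_CPSeries (A : nat -> R) (z : C) : Rbar_le 1 (CV_radius A) ->
  Cmod z < 1 ->
  is_cderive (CPSeries (fun n => RtoC (A n))) z (CPSeries (fun n => RtoC (PS_derive A n)) z).
Proof.
intros HA Hz eps Heps. pose proof (Cmod_ge_0 z) as Hz0.
assert (HA1 : Rbar_le 1 (CV_radius (PS_derive A))) by now rewrite CV_radius_derive.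
set (r := (1 + Cmod z) / 2).
assert (Hr : Cmod z < r < 1) by (unfold r; lra).
set (b n := Rabs (PS_derive (PS_derive A) n * r ^ n)).
assert (Hb : ex_series b).
{ apply CV_disk_inside. rewrite !CV_radius_derive.
  eapply Rbar_lt_le_trans; [|exact HA]. simpl. rewrite Rabs_pos_eq; lra. }
set (M := Series b).
assert (HM : 0 <= M).
{ unfold M. replace 0 with (Series (fun n => 0 * b n)) by (rewrite Series_scal_l; ring).
  apply Series_le; [|exact Hb]. intros n. assert (0 <= b n) by apply Rabs_pos. lra. }
exists (Rmin (r - Cmod z) (eps / (2 * M + 1))); split.
{ apply Rmin_glb_lt; [lra|]. apply Rdiv_lt_0_compat; lra. }
intros h Hh. apply Rmin_Rgt in Hh. destruct Hh as [Hh1 Hh2].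
pose proof (Cmod_ge_0 h) as Hh0.
assert (Hzh : Cmod (z + h)%C <= r) by (eapply Rle_trans; [apply Cmod_triangle|lra]).
pose (U n := (RtoC (A n) * (z + h) ^ n)%C).
pose (V n := (RtoC (A n) * z ^ n)%C).
pose (W n := (RtoC (PS_derive A n) * z ^ n)%C).
assert (HU : abs_summable U) by (apply abs_summable_pseries; [exact HA|lra]).
assert (HV : abs_summable V) by (apply abs_summable_pseries; [exact HA|lra]).
assert (HW : abs_summable W) by (apply abs_summable_pseries; [exact HA1|lra]).
pose proof (proj1 (abs_summable_incr_1 U) HU) as HU'.
pose proof (proj1 (abs_summable_incr_1 V) HV) as HV'.
(* [U] and [V] are shifted by one to align with the index of [PS_derive]. The term [X 0] is the
   remainder of a linear function, hence zero, which permits the second shift needed for the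
   quadratic bound. *)
pose (X n := (U (S n) + (-1 * V (S n)) + (- h) * W n)%C).
assert (HV'' : abs_summable (fun n => -1 * V (S n))%C) by now apply abs_summable_scal.
assert (HW' : abs_summable (fun n => - h * W n)%C) by now apply abs_summable_scal.
assert (HUV : abs_summable (fun n => U (S n) + (-1 * V (S n)))%C)
  by now apply abs_summable_plus.
assert (HX : abs_summable X) by now apply abs_summable_plus.
assert (E : (CPSeries (fun n => RtoC (A n)) (z + h) - CPSeries (fun n => RtoC (A n)) z
  - CPSeries (fun n => RtoC (PS_derive A n)) z * h)%C = csum (fun n => X (S n))).
{ change ((csum U - csum V - csum W * h)%C = csum (fun n => X (S n))).
  assert (EX : csum X = (X O + csum (fun n => X (S n)))%C) by now apply csum_incr_1.
  assert (EX0 : X O = 0).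
  { unfold X, U, V, W, PS_derive. simpl. rewrite Rmult_1_l. ring. }
  rewrite EX0, Cplus_0_l in EX. rewrite <- EX.
  unfold X. rewrite csum_plus, csum_plus, !csum_scal by assumption.
  rewrite (csum_incr_1 U HU), (csum_incr_1 V HV).
  unfold U at 1, V at 1. simpl. ring. }
rewrite E.
assert (K : Cmod (csum (fun n => X (S n))) <= 2 * Series (fun n => Cmod h ^ 2 * b n)).
{ apply Cmod_csum_le; [|now apply (ex_series_scal (V := R_NormedModule) (Cmod h ^ 2))].
  intros n.
  replace (X (S n)) with (RtoC (A (S (S n))) *
    ((z + h) ^ S (S n) - z ^ S (S n) - RtoC (INR (S (S n))) * z ^ S n * h))%C.
  2:{ unfold X, U, V, W, PS_derive. rewrite RtoC_mult. ring. }
  rewrite Cmod_mult, Cmod_R. unfold b, PS_derive.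
  rewrite !Rabs_mult, (Rabs_pos_eq (INR (S n))), (Rabs_pos_eq (INR (S (S n))))
    by apply pos_INR.
  rewrite (Rabs_pos_eq (r ^ n)) by (apply pow_le; lra).
  eapply Rle_trans.
  - apply Rmult_le_compat_l; [apply Rabs_pos|].
    apply pow_increment_bound with (r := r); [lra|exact Hzh].
  - right. ring. }
eapply Rle_trans; [exact K|]. rewrite Series_scal_l. fold M.
assert (K2 : Cmod h * (2 * M + 1) <= eps).
{ apply Rle_trans with (eps / (2 * M + 1) * (2 * M + 1)).
  - apply Rmult_le_compat_r; lra.
  - right. field. lra. }
apply Rle_trans with (Cmod h * (2 * M + 1) * Cmod h); [nra|].
apply Rmult_le_compat_r; lra.
Qed.

(** * The hypergeometric coefficients *)

(** The coefficients for c = a + b + 1 are real even for complex a and b, because (a + k)(b + k) =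
    k^2 + s k + m with s = a + b and m = ab. *)
Fixpoint hyp_coeff (s m : R) (n : nat) : R :=
  match n with
  | O => 1
  | S k => hyp_coeff s m k * (INR k ^ 2 + s * INR k + m) / ((s + 1 + INR k) * INR (S k))
  end.

Lemma hyp2F1_coeff (s m : R) (a b : C) (n : nat) : 0 <= s ->
  (a + b)%C = RtoC s -> (a * b)%C = RtoC m ->
  (Cpoch a n * Cpoch b n / (Cpoch (a + b + 1) n * RtoC (INR (fact n))))%C
  = RtoC (hyp_coeff s m n).
Proof.
intros Hs Hab Hm. rewrite Hab.
assert (Hc : forall k, (RtoC s + 1 + RtoC (INR k))%C <> 0).
{ intros k K. rewrite <- !RtoC_plus in K. apply RtoC_inj in K. pose proof (pos_INR k). lra. }
assert (Hf : forall k, RtoC (INR (fact k)) <> 0).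
{ intros k K. apply RtoC_inj in K. now apply INR_fact_neq_0 in K. }
assert (HS : forall k, RtoC (INR (S k)) <> 0).
{ intros k K. apply RtoC_inj in K. now apply not_0_INR in K. }
assert (Hp : forall k, Cpoch (RtoC s + 1) k <> 0).
{ induction k as [|k IH].
  - simpl. intros K. apply RtoC_inj in K. lra.
  - simpl. apply Cmult_neq_0; [exact IH|apply Hc]. }
induction n as [|n IH].
- simpl. field.
- change (Cpoch a (S n)) with (Cpoch a n * (a + RtoC (INR n)))%C.
  change (Cpoch b (S n)) with (Cpoch b n * (b + RtoC (INR n)))%C.
  change (Cpoch (RtoC s + 1) (S n)) with (Cpoch (RtoC s + 1) n * (RtoC s + 1 + RtoC (INR n)))%C.
  rewrite fact_simpl, mult_INR.
  cbn [hyp_coeff]. unfold Rdiv.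
  rewrite RtoC_mult, RtoC_mult, RtoC_inv, RtoC_mult, <- IH.
  2:{ apply Rmult_integral_contrapositive_currified; [|now apply not_0_INR].
      pose proof (pos_INR n). lra. }
  replace (RtoC (INR n ^ 2 + s * INR n + m)) with ((a + RtoC (INR n)) * (b + RtoC (INR n)))%C.
  2:{ rewrite !RtoC_plus, RtoC_mult, RtoC_pow, <- Hab, <- Hm. ring. }
  rewrite !RtoC_mult, !RtoC_plus. field. auto.
Qed.

(** For m <= 2 s + 2 the ratio of consecutive coefficients is at most (n + 2) / (n + 1), which
    telescopes to linear growth; this suffices for radius of convergence at least 1. *)
Lemma hyp_coeff_bound (s m : R) (n : nat) : 0 <= s -> 0 <= m -> m <= 2 * s + 2 ->
  0 <= hyp_coeff s m n <= INR (S n).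
Proof.
intros Hs Hm Hms. induction n as [|n IH]; [simpl; lra|].
pose proof (pos_INR n) as Hn. cbn [hyp_coeff].
rewrite (S_INR (S n)). rewrite (S_INR n) in *. set (x := INR n) in *.
assert (Hd : 0 < (s + 1 + x) * (x + 1)) by (apply Rmult_lt_0_compat; lra).
assert (Hx : 0 <= x ^ 2 + s * x + m) by nra.
split.
- apply Rdiv_le_0_compat; [|exact Hd]. apply Rmult_le_pos; lra.
- apply Rmult_le_reg_r with (1 := Hd). unfold Rdiv.
  rewrite Rmult_assoc, Rinv_l, Rmult_1_r by lra.
  apply Rle_trans with ((x + 1) * (x ^ 2 + s * x + m)).
  + apply Rmult_le_compat_r; lra.
  + replace ((x + 1 + 1) * ((s + 1 + x) * (x + 1)))
      with ((x + 1) * ((x + 2) * (s + 1 + x))) by ring.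
    apply Rmult_le_compat_l; [lra|]. nra.
Qed.

Lemma CV_radius_linear_bound (A : nat -> R) :
  (forall n, Rabs (A n) <= INR (S n)) -> Rbar_le 1 (CV_radius A).
Proof.
intros HA. destruct (CV_radius_bounded A) as [Hub _].
assert (K : forall r, 0 <= r < 1 -> Rbar_le r (CV_radius A)).
{ intros r Hr. apply Hub. exists (/ (1 - r)). intros n.
  (* Divided by 1 - r, this says that (n + 1) r^n is at most the geometric sum 1 + r + ... + r^n. *)
  assert (B : INR (S n) * r ^ n * (1 - r) <= 1 - r ^ S n).
  { induction n as [|n IH]; [simpl; lra|].
    rewrite (S_INR (S n)). simpl pow in *.
    assert (P1 : 0 <= r ^ n) by (apply pow_le; lra).
    assert (P2 : r * (r ^ n) * (1 - r) <= 1 - r).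
    { assert (r ^ S n <= 1) by (rewrite <- (pow1 (S n)); apply pow_incr; lra).
      simpl in H. nra. }
    assert (P3 : r * (INR (S n) * r ^ n * (1 - r)) <= r * (1 - r * r ^ n))
      by (apply Rmult_le_compat_l; lra).
    lra. }
  assert (P : 0 <= r ^ S n) by (apply pow_le; lra).
  apply Rmult_le_reg_r with (1 - r); [lra|]. rewrite Rinv_l by lra.
  rewrite Rabs_mult, (Rabs_pos_eq (r ^ n)) by (apply pow_le; lra).
  apply Rle_trans with (INR (S n) * r ^ n * (1 - r)); [|lra].
  apply Rmult_le_compat_r; [lra|]. apply Rmult_le_compat_r; [apply pow_le; lra|apply HA]. }
pose proof (CV_radius_ge_0 A) as H0.
destruct (CV_radius A) as [c| |]; simpl in *; [|trivial|contradiction].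
apply Rnot_lt_le. intros Hc. specialize (K ((1 + c) / 2) ltac:(lra)). lra.
Qed.

(** With c = a + b + 1 the factor 1 - z splits off both derivative terms of the hypergeometric
    equation, leaving (1 - z)(z F'' + (s + 1) F') = m F. It expresses the coefficient recurrence. *)
Lemma hyp_coeff_ode (s m : R) (z : C) : 0 <= s ->
  let A := hyp_coeff s m in
  let P B := CPSeries (fun n => RtoC (B n)) z in
  Rbar_le 1 (CV_radius A) -> Cmod z < 1 ->
  ((1 - z) * (P (PS_derive A) + z * P (PS_derive (PS_derive A)) + RtoC s * P (PS_derive A)))%C
  = (RtoC m * P A)%C.
Proof.
intros Hs A P HA Hz.
assert (HA1 : Rbar_le 1 (CV_radius (PS_derive A))) by now rewrite CV_radius_derive.
assert (HA2 : Rbar_le 1 (CV_radius (PS_derive (PS_derive A)))) by now rewrite !CV_radius_derive.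
pose (U (B : nat -> R) n := (RtoC (B n) * z ^ n)%C).
assert (S0 : abs_summable (U A)) by now apply abs_summable_pseries.
assert (S1 : abs_summable (U (PS_derive A))) by now apply abs_summable_pseries.
assert (S2 : abs_summable (U (PS_derive (PS_derive A)))) by now apply abs_summable_pseries.
assert (Hs1 : abs_summable (fun n => RtoC s * U (PS_derive A) n)%C) by now apply abs_summable_scal.
assert (Hs2 : abs_summable (fun n => z * U (PS_derive (PS_derive A)) n)%C)
  by now apply abs_summable_scal.
assert (Hs0 : abs_summable (fun n => RtoC m * U A n)%C) by now apply abs_summable_scal.
pose (E n := (RtoC (INR n * PS_derive A n) * z ^ n)%C).
assert (E1 : forall n, (z * U (PS_derive (PS_derive A)) n)%C = E (S n)).
{ intros n. unfold E, U, PS_derive. rewrite !RtoC_mult. cbn [Cpow]. ring. }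
assert (HE : abs_summable E).
{ apply abs_summable_incr_1. exact (abs_summable_ext _ _ E1 Hs2). }
assert (EE : csum E = (z * csum (U (PS_derive (PS_derive A))))%C).
{ rewrite (csum_incr_1 E HE), <- csum_scal by exact S2.
  rewrite (csum_ext _ _ E1). unfold E at 1. simpl INR. rewrite Rmult_0_l. ring. }
pose (G n := (U (PS_derive A) n + E n + RtoC s * U (PS_derive A) n)%C).
assert (HG : abs_summable G) by (apply abs_summable_plus; [now apply abs_summable_plus|assumption]).
assert (EG : csum G = (P (PS_derive A) + z * P (PS_derive (PS_derive A))
  + RtoC s * P (PS_derive A))%C).
{ unfold G. rewrite csum_plus, csum_plus, csum_scal, EE; try assumption.
  - reflexivity.
  - now apply abs_summable_plus. }
rewrite <- EG.
(* With theta = z d/dz, [G] sums to z F'' + (s + 1) F' and [H] to theta (theta + s) F, which is z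
   times the former. The recurrence reads G = H + m F term by term. *)
pose (H n := (RtoC (INR n * (INR n + s) * A n) * z ^ n)%C).
assert (H1 : forall n, (z * G n)%C = H (S n)).
{ intros n. unfold H, G, U, E, PS_derive. rewrite !S_INR, !RtoC_mult, !RtoC_plus.
  cbn [Cpow]. ring. }
assert (HzG : abs_summable (fun n => z * G n)%C) by now apply abs_summable_scal.
assert (HH : abs_summable H).
{ apply abs_summable_incr_1. exact (abs_summable_ext _ _ H1 HzG). }
assert (EH : csum H = (z * csum G)%C).
{ rewrite (csum_incr_1 H HH), <- csum_scal by exact HG.
  rewrite (csum_ext _ _ H1). unfold H at 1. simpl INR. rewrite !Rmult_0_l. ring. }
assert (EGH : csum G = (csum H + RtoC m * csum (U A))%C).
{ rewrite <- csum_scal, <- csum_plus by assumption. apply csum_ext. intros n.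
  unfold G, H, E, U, PS_derive.
  assert (Hrec : INR (S n) * A (S n) * (INR n + 1 + s)
    = INR n * (INR n + s) * A n + m * A n).
  { unfold A. cbn [hyp_coeff]. field. pose proof (pos_INR n).
    split; [now apply not_0_INR|lra]. }
  transitivity (RtoC (INR (S n) * A (S n) * (INR n + 1 + s)) * z ^ n)%C.
  - rewrite !RtoC_mult, !RtoC_plus. ring.
  - rewrite Hrec. repeat rewrite ?RtoC_mult, ?RtoC_plus. ring. }
change (P A) with (csum (U A)).
replace ((1 - z) * csum G)%C with (csum G - z * csum G)%C by ring.
rewrite <- EH, EGH. ring.
Qed.

Lemma CPSeries_0 (A : nat -> R) : Rbar_le 1 (CV_radius A) ->
  CPSeries (fun n => RtoC (A n)) 0 = RtoC (A O).
Proof.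
intros HA.
assert (S0 : abs_summable (fun n => RtoC (A n) * 0 ^ n)%C).
{ apply abs_summable_pseries; [exact HA|]. rewrite Cmod_0. lra. }
change (csum (fun n => RtoC (A n) * 0 ^ n)%C = RtoC (A O)).
rewrite csum_incr_1 by exact S0.
(* The terms of positive index vanish; written as 0 times a summable sequence, they are removed by
   [csum_scal]. *)
rewrite (csum_ext _ (fun n => 0 * (RtoC (A n) * 0 ^ n))%C) by (intros n; simpl; ring).
rewrite csum_scal by exact S0. simpl. ring.
Qed.

(** * From the half-planes to the sector, and the theorem *)

Lemma Carg_sector (phi : R) (w : C) : 0 < phi < PI / 2 ->
  0 < Re ((sin phi, cos phi) * w)%C -> 0 < Re ((sin phi, (- cos phi)%R) * w)%C ->
  w <> 0 /\ Rabs (Carg w) < phi.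
Proof.
intros Hphi H1 H2. pose proof PI_RGT_0 as HPI.
assert (Hw : w <> 0).
{ intros K. rewrite K in H1. unfold Re in H1; simpl in H1. lra. }
split; [exact Hw|].
destruct (Carg_spec w Hw) as [Hb [HR HI]].
set (t := Carg w) in *. apply Cmod_gt_0 in Hw. set (r := Cmod w) in *.
(* The two hypotheses are r sin (phi - t) > 0 and r sin (phi + t) > 0. Their sum is 2 r sin phi cos
   t, so |t| < pi/2, and in that range the signs of the two sines force |t| < phi. *)
assert (K1 : 0 < r * sin (phi - t)).
{ rewrite sin_minus. unfold Re, Im in *; simpl in H1. rewrite HR, HI in H1. lra. }
assert (K2 : 0 < r * sin (phi + t)).
{ rewrite sin_plus. unfold Re, Im in *; simpl in H2. rewrite HR, HI in H2. lra. }
assert (S1 : 0 < sin (phi - t)) by (apply Rmult_lt_reg_l with r; lra).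
assert (S2 : 0 < sin (phi + t)) by (apply Rmult_lt_reg_l with r; lra).
assert (Sp : 0 < sin phi) by (apply sin_gt_0; lra).
assert (Hc : 0 < cos t).
{ rewrite sin_minus in S1. rewrite sin_plus in S2.
  apply Rmult_lt_reg_l with (sin phi); lra. }
assert (Ht1 : t < PI / 2).
{ apply Rnot_le_lt. intros K. pose proof (cos_le_0 t K ltac:(lra)). lra. }
assert (Ht2 : - (PI / 2) < t).
{ apply Rnot_le_lt. intros K. rewrite <- cos_neg in Hc.
  pose proof (cos_le_0 (- t) ltac:(lra) ltac:(lra)). lra. }
apply Rabs_def1; apply Rnot_le_lt; intros K.
- pose proof (sin_ge_0 (t - phi) ltac:(lra) ltac:(lra)) as Q.
  replace (t - phi) with (- (phi - t)) in Q by ring. rewrite sin_neg in Q. lra.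
- pose proof (sin_ge_0 (- t - phi) ltac:(lra) ltac:(lra)) as Q.
  replace (- t - phi) with (- (phi + t)) in Q by ring. rewrite sin_neg in Q. lra.
Qed.

(** The inequality of [half_plane] divided by |F|^2; since it is strict, it also excludes zeros of
    [F]. *)
Lemma hyp2F1_half_plane (s m S n : R) : 0 <= s -> 0 < m -> m <= 2 * s + 2 ->
  1 / 2 < S -> S ^ 2 + n ^ 2 = 1 ->
  (s - 1) ^ 2 * n ^ 2 + (4 * S ^ 2 - 1) * (1 - 2 * s + m) <= 0 ->
  let F := CPSeries (fun k => RtoC (hyp_coeff s m k)) in
  let F1 := CPSeries (fun k => RtoC (PS_derive (hyp_coeff s m) k)) in
  forall z, Cmod z < 1 ->
  F z <> 0 /\ 0 < Re ((S, n) * ((F z + z * F1 z) / F z))%C.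
Proof.
intros Hs Hm Hms HS Hn Hc F F1 z Hz.
set (A := hyp_coeff s m) in *.
assert (HA : Rbar_le 1 (CV_radius A)).
{ apply CV_radius_linear_bound. intros k.
  destruct (hyp_coeff_bound s m k Hs (Rlt_le _ _ Hm) Hms) as [B1 B2].
  unfold A. now rewrite Rabs_pos_eq. }
assert (HA1 : Rbar_le 1 (CV_radius (PS_derive A))) by now rewrite CV_radius_derive.
assert (HA2 : Rbar_le 1 (CV_radius (PS_derive (PS_derive A)))) by now rewrite !CV_radius_derive.
assert (K : 0 < Re ((S, n) * (z * F1 z + F z) * Cconj (F z))%C).
{ apply (half_plane F F1 (CPSeries (fun k => RtoC (PS_derive (PS_derive A) k)))
    (CPSeries (fun k => RtoC (PS_derive (PS_derive (PS_derive A)) k))) s m S n);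
    try assumption.
  - intros w Hw. now apply is_cderive_CPSeries.
  - intros w Hw. now apply is_cderive_CPSeries.
  - intros w Hw. now apply is_cderive_CPSeries.
  - intros w Hw. now apply hyp_coeff_ode.
  - unfold F. now rewrite CPSeries_0. }
assert (HF : F z <> 0).
{ intros E. rewrite E in K. unfold Re in K; simpl in K. lra. }
split; [exact HF|].
assert (HN : 0 < Cmod (F z) ^ 2) by now apply pow_lt, Cmod_gt_0.
apply Rmult_lt_reg_r with (1 := HN). rewrite Rmult_0_l.
replace (Re ((S, n) * ((F z + z * F1 z) / F z))%C * Cmod (F z) ^ 2)
  with (Re ((S, n) * ((F z + z * F1 z) / F z) * RtoC (Cmod (F z) ^ 2)%R)%C)
  by (unfold Re; simpl; ring).
rewrite Cmod2_conj.
replace ((S, n) * ((F z + z * F1 z) / F z) * (F z * Cconj (F z)))%C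
  with ((S, n) * (z * F1 z + F z) * Cconj (F z))%C by (field; exact HF).
exact K.
Qed.

Theorem theorem1p7 : forall (alpha : R) (a b : C),
  1 / 3 < alpha < 1 ->
  Im (a + b)%C = 0 ->
  Im (a * b)%C = 0 ->
  0 < Re (a * b)%C ->
  (* the expression below is real because a + b and a * b are *)
  0 <= Re (((a - b) ^ 2 + 6 * (a + b) - 3) * RtoC (sin (PI * alpha / 2) ^ 2)
           - a ^ 2 - a * b - b ^ 2)%C ->
  strongly_starlike alpha (fun z : C => (z * hyp2F1 a b (a + b + 1) z)%C).
Proof.
intros alpha a b Halpha Hab Hm Hm0 Hcond.
pose proof PI_RGT_0 as HPI.
set (phi := PI * alpha / 2) in *.
set (S := sin phi) in *. set (n := cos phi).
set (s := Re (a + b)%C). set (m := Re (a * b)%C) in *.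
(* The bound alpha > 1/3 enters here: it gives sin phi > 1/2, so that the leading coefficient -(4
   S^2 - 1)/2 of the quadratic on the boundary line is negative. *)
assert (Hphi : PI / 6 < phi < PI / 2) by (unfold phi; nra).
assert (HS : 1 / 2 < S).
{ rewrite <- sin_PI6. apply sin_increasing_1; lra. }
assert (HSn : S ^ 2 + n ^ 2 = 1).
{ pose proof (sin2_cos2 phi) as K. unfold Rsqr in K. unfold S, n. lra. }
assert (Eab : (a + b)%C = RtoC s).
{ rewrite (surjective_pairing (a + b)%C). unfold RtoC, s, Re. f_equal. exact Hab. }
assert (Em : (a * b)%C = RtoC m).
{ rewrite (surjective_pairing (a * b)%C). unfold RtoC, m, Re. f_equal. exact Hm. }
(* In terms of s and m the hypothesis is (s^2 - 4 m + 6 s - 3) S^2 - s^2 + m >= 0; the left side of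
   [Hc] is its negative, by n^2 = 1 - S^2. *)
assert (Hc : (s - 1) ^ 2 * n ^ 2 + (4 * S ^ 2 - 1) * (1 - 2 * s + m) <= 0).
{ replace (n ^ 2) with (1 - S ^ 2) by lra.
  replace (((a - b) ^ 2 + 6 * (a + b) - 3) * RtoC (S ^ 2) - a ^ 2 - a * b - b ^ 2)%C
    with (((a + b) * (a + b) - 4 * (a * b) + 6 * (a + b) - 3) * RtoC (S ^ 2)
      - (a + b) * (a + b) + a * b)%C in Hcond.
  - rewrite Eab, Em in Hcond. unfold Re in Hcond; simpl in Hcond. simpl. lra.
  - ring. }
assert (Hk : 0 < 4 * S ^ 2 - 1) by nra.
(* With m > 0 this forces s > 1/2, although no sign of a + b is assumed, and it also supplies the
   coefficient condition m <= 2 s + 2. *)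
assert (Hms : m <= 2 * s - 1).
{ assert (0 <= (s - 1) ^ 2 * n ^ 2) by (apply Rmult_le_pos; apply pow2_ge_0).
  assert (1 - 2 * s + m <= 0); [|lra].
  apply Rmult_le_reg_l with (4 * S ^ 2 - 1); lra. }
set (F := CPSeries (fun k => RtoC (hyp_coeff s m k))).
set (F1 := CPSeries (fun k => RtoC (PS_derive (hyp_coeff s m) k))).
assert (EF : forall z, hyp2F1 a b (a + b + 1) z = F z).
{ intros z. unfold hyp2F1, F, CPSeries.
  f_equal; apply Series_ext; intros k; (rewrite (hyp2F1_coeff s m) by (assumption || lra));
    reflexivity. }
assert (HA : Rbar_le 1 (CV_radius (hyp_coeff s m))).
{ apply CV_radius_linear_bound. intros k.
  destruct (hyp_coeff_bound s m k) as [B1 B2]; [lra..|]. now rewrite Rabs_pos_eq. }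
assert (F0 : F 0 = 1) by (unfold F; now rewrite CPSeries_0).
set (f := fun z : C => (z * hyp2F1 a b (a + b + 1) z)%C).
assert (Hf : forall z, Cmod z < 1 ->
  @is_derive C_AbsRing C_NormedModule f z (F z + z * F1 z)%C).
{ intros z Hz. apply (is_derive_ext (fun w => w * F w)%C).
  - intros w. unfold f. now rewrite EF.
  - apply is_cderive_is_derive. eapply is_cderive_eq.
    + apply is_cderive_mult; [apply is_cderive_id|now apply is_cderive_CPSeries].
    + unfold F1. ring. }
assert (Hf' : forall z, Cmod z < 1 -> C_derive f z = (F z + z * F1 z)%C).
{ intros z Hz. now apply is_C_derive_unique, Hf. }
assert (H0 : Cmod 0 < 1) by (rewrite Cmod_0; lra).
split; [|split; [|split]].
- intros z Hz. eexists. apply Hf, Hz.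
- unfold f. ring.
- rewrite Hf' by exact H0. rewrite F0. ring.
- intros z Hz.
  assert (Hn' : S ^ 2 + (- n) ^ 2 = 1) by (rewrite <- HSn; ring).
  assert (Hc' : (s - 1) ^ 2 * (- n) ^ 2 + (4 * S ^ 2 - 1) * (1 - 2 * s + m) <= 0)
    by (replace ((- n) ^ 2) with (n ^ 2) by ring; exact Hc).
  destruct (hyp2F1_half_plane s m S n ltac:(lra) Hm0 ltac:(lra) HS HSn Hc z Hz) as [HF D1].
  destruct (hyp2F1_half_plane s m S (- n) ltac:(lra) Hm0 ltac:(lra) HS Hn' Hc' z Hz) as [_ D2].
  fold F F1 in HF, D1, D2.
  split; [intros Hz0; unfold f; rewrite EF; now apply Cmult_neq_0|].
  assert (Eq : starlike_quot f z = ((F z + z * F1 z) / F z)%C).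
  { unfold starlike_quot. destruct (Ceq_dec z 0) as [E|E].
    - rewrite E, F0. field.
    - rewrite Hf' by exact Hz. unfold f. rewrite EF. field. split; assumption. }
  rewrite Eq. replace (PI / 2 * alpha) with phi by (unfold phi; field).
  apply Carg_sector; [lra|exact D1|exact D2].
Qed.
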